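(* Let $k$ be a positive integer and let $G$ be a finite simple $2$-connected $k$-regular graph on $n$ vertices. Let $P=uvz$ be a path of $G$ (so $u,v,z$ are distinct, $uv,vz\in E(G)$) such that $\{u,v,z\}$ is not a cut-set of $G$, i.e. $G-\{u,v,z\}$ is connected. If $G$ does not belong to the class $\mathscr{H}$ with respect to $P$ and $n\leqslant 2k+1$, then $G$ has a Hamiltonian cycle containing the path $P$ (i.e. containing both edges $uv$ and $vz$).
   Context: All graphs are finite and simple. Class $\mathscr{H}$: for a $k$-regular graph $G$ and a path $P=uvz$ of $G$, we say that $G$ belongs to $\mathscr{H}$ with respect to $P$ if there is an integer $q\geqslant k$ such that $G$ is a $2$-connected $k$-regular graph on $2q+1$ vertices which contains two disjoint vertex sets $X$ and $Y$ with $Y$ independent, $\{u,v,z\}\subseteq X$, $|Y|=q$, $|X|=q+1$, $N(Y)\subseteq X$ (where $N(Y)$ is the set of vertices adjacent to some vertex of $Y$), and $v$ adjacent to both $u$ and $z$. A Hamiltonian cycle is a cycle containing all vertices of $G$. *)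

(* Defs.v *)
From mathcomp Require Import all_boot.
Set Implicit Arguments. Unset Strict Implicit. Unset Printing Implicit Defensive.

Definition simple_graph (T : finType) (e : rel T) : Prop :=
  symmetric e /\ irreflexive e.

Definition nbhd (T : finType) (e : rel T) (x : T) : {set T} := [set y | e x y].
Definition k_regular (T : finType) (e : rel T) (k : nat) : Prop :=
  forall x : T, #|nbhd e x| = k.

(* The subgraph induced on S is connected: any two vertices of S are joined
   by a path all of whose vertices lie in S (vacuous for S empty). *)
Definition induced_rel (T : finType) (e : rel T) (S : {set T}) : rel T :=
  [rel x y | [&& e x y, x \in S & y \in S]].
Definition connected_on (T : finType) (e : rel T) (S : {set T}) : Prop :=
  forall x y, x \in S -> y \in S -> connect (induced_rel e S) x y.

Definition two_connected (T : finType) (e : rel T) : Prop :=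
  3 <= #|T| /\ connected_on e [set: T] /\
  forall x : T, connected_on e [set~ x].

Definition independent (T : finType) (e : rel T) (Y : {set T}) : Prop :=
  forall x y, x \in Y -> y \in Y -> ~~ e x y.

Definition nbhd_set (T : finType) (e : rel T) (Y : {set T}) : {set T} :=
  [set x | [exists y in Y, e y x]].

Definition in_classH (T : finType) (e : rel T) (k : nat) (u v z : T) : Prop :=
  exists q : nat, [/\ k <= q, two_connected e, k_regular e k,
    #|T| = q.*2.+1 &
    exists X Y : {set T}, [/\ [disjoint X & Y], independent e Y,
       [set u; v; z] \subset X, #|Y| = q &
       [/\ #|X| = q.+1, nbhd_set e Y \subset X, e v u & e v z]]].

Definition ham_cycle (T : finType) (e : rel T) (c : seq T) : Prop :=
  [/\ uniq c, size c = #|T|, 3 <= size c & cycle e c].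

Definition cycle_has_edge (T : finType) (c : seq T) (a b : T) : bool :=
  [&& a \in c, b \in c & (next c a == b) || (next c b == a)].

(* Main.v *)
(** Suppose no Hamiltonian cycle contains the path [u v z], and let [Q] be a
longest [u]-[z] path of [G - v].  For a component [D] of [G - v - Q], the
successors on [Q] of the attachments of [D] are independent, and a crossing
argument bounds the degree sum of two of them.  By the connectivity of [G] and
of [G - {u, v, z}] there are two attachments other than the pair [u], [z]; since
[n <= 2k + 1] this gives [#|D| <= 3] and forces most of these successors to be neighbours of [v].  The
degree of [v] then leaves only [k = 4], [n = 9] when [#|D| > 1], which the
length of [Q] excludes.  Hence the vertices outside every longest path are
independent, and each of them is adjacent to [v], for otherwise it has [k]
neighbours on [Q] and forms with their successors an independent set of [k]
vertices, which puts [G] in the class H.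
Now fix [y] outside [Q].  If both neighbours on [Q] of a vertex [w] are adjacent
to [y], then exchanging [w] and [y] gives another longest path, so [w] is
adjacent to [v] as well.  The degree of [v] then shows that [y] is the only
vertex outside [Q] and that [N(y)] almost alternates along [Q]; counting the
edges inside and outside [N(y) + v] contradicts regularity, except in two
configurations where [Q + y] can be rerouted into a longer path. *)
Require Import Defs.
From mathcomp Require Import all_boot zify.
Set Implicit Arguments. Unset Strict Implicit. Unset Printing Implicit Defensive.

Ltac nlia :=
  repeat match goal with
  | H : ?P |- _ => lazymatch P with
    | nat => fail
    | @eq nat _ _ => fail
    | is_true (leq _ _) => fail
    | is_true (negb (@eq_op Datatypes_nat__canonical__eqtype_Equality _ _)) => fail
    | _ => clear H
    end
  end; lia.

(** * Walks, segments of a path, and distinctness by counting *)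

Section Blocks.
Variables (T : finType) (e : rel T).
Hypothesis e_sym : symmetric e.

(** Vertices may repeat: rerouted paths are assembled from blocks by [walk_cat], and distinctness is
    recovered afterwards from multiplicities. *)
Definition walk (a b : T) (s : seq T) : bool :=
  [&& s != [::], sorted e s, head a s == a & last b s == b].

Lemma walk1 a : walk a a [:: a].
Proof. by rewrite /walk /= !eqxx. Qed.

Lemma walk_cat a b c d s t : walk a b s -> walk c d t -> e b c -> walk a d (s ++ t).
Proof.
case: s => [|x s] //; case: t => [|y t] // /and4P[_ /= ss /eqP xa /eqP lb].
case/and4P=> _ /= st /eqP yc /eqP ld; rewrite -yc => ebc.
by rewrite /walk /= cat_path last_cat /= lb ebc ld st ss xa !eqxx.
Qed.

Lemma walk_rev a b s : walk a b s -> walk b a (rev s).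
Proof.
rewrite /walk -!size_eq0 size_rev rev_sorted.
rewrite (eq_sorted (e' := e)); last by move=> p q; rewrite e_sym.
case: s => [|x s] // /and4P[_ /= ss /eqP xa lb]; rewrite {x}xa in ss lb *.
rewrite rev_cons last_rcons eqxx andbT -rev_cons.
case/lastP: s ss lb => [|s y] ss /=; first by rewrite /rev /= => ->.
by rewrite last_rcons -rcons_cons rev_rcons /= => ->; rewrite ss.
Qed.

Lemma walk_path a q : path e a q -> walk a (last a q) (a :: q).
Proof. by move=> pq; rewrite /walk /= eqxx pq eqxx. Qed.

(** Both ends [i] and [j] are included. *)
Definition seg (Q : seq T) i j := take (j.+1 - i) (drop i Q).

Lemma count_seg P Q a b c : a <= b -> b < c ->
  count P (seg Q a c) = count P (seg Q a b) + count P (seg Q b.+1 c).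
Proof.
move=> ab bc; rewrite /seg -count_cat.
have -> : drop b.+1 Q = drop (b.+1 - a) (drop a Q) by rewrite drop_drop; congr drop; lia.
rewrite -{1}(cat_take_drop (b.+1 - a) (take (c.+1 - a) _)) take_takel; last lia.
by rewrite (take_drop (c.+1 - b.+1)); congr (count _ (_ ++ drop _ (take _ _))); lia.
Qed.

Lemma seg_full Q : seg Q 0 (size Q).-1 = Q.
Proof. by rewrite /seg drop0 subn0 take_oversize //; case: Q. Qed.

Lemma count_seg1 v P Q i : i < size Q -> count P (seg Q i i) = P (nth v Q i).
Proof. by move=> iQ; rewrite /seg subSnn (drop_nth v) //= take0 /= addn0. Qed.

Lemma walk_seg v Q i j : sorted e Q -> i <= j -> j < size Q ->
  walk (nth v Q i) (nth v Q j) (seg Q i j).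
Proof.
move=> sQ ij jQ; have iQ : i < size Q by lia.
have szs : size (seg Q i j) = j.+1 - i by rewrite size_takel // size_drop; lia.
rewrite /walk -size_eq0 szs.
have -> /= : j.+1 - i != 0 by lia.
rewrite take_sorted ?drop_sorted //=.
have nths k : k <= j - i -> nth v (seg Q i j) k = nth v Q (i + k).
  by move=> kl; rewrite nth_take ?nth_drop //; lia.
have := nths 0 isT; have := nths (j - i) (leqnn _); rewrite addn0 subnKC //.
have -> : j - i = (size (seg Q i j)).-1 by rewrite szs; lia.
by rewrite nth_last; case: (seg _ _ _) szs => [|y s] /=; [lia | move=> _ -> ->; rewrite !eqxx].
Qed.

(** Comparing [count P] for every [P] turns the distinctness of a rerouted path into additive
    identities, which [count_seg] and linear arithmetic settle. *)
Lemma uniq_count_leq (s t : seq T) :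
  uniq t -> (forall P, count P s <= count P t) -> uniq s.
Proof.
move=> ut st; apply: count_mem_uniq => x.
have: count_mem x s <= 1 by rewrite (leq_trans (st _)) // count_uniq_mem // leq_b1.
have [xs|xs] := boolP (x \in s); last by rewrite (count_memPn xs).
by move: xs; rewrite -has_pred1 has_count; lia.
Qed.
End Blocks.

(** * Longest [u]-[z] paths avoiding [v] *)

Section Longest.
Variables (T : finType) (e : rel T).
Hypothesis e_sym : symmetric e.

(** Adding [v] closes such a path to a cycle through [u v z]; the cycle is Hamiltonian once the path
    covers every vertex but [v]. *)
Definition hpath (u v z : T) (Q : seq T) : bool := uniq (v :: Q) && walk e u z Q.

Definition longest (u v z : T) (Q : seq T) : Prop :=
  hpath u v z Q /\ forall Q', hpath u v z Q' -> size Q' <= size Q.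

(** Exchanges the roles of [u] and [z]; together with [setting_sym] it turns statements on
    successors into statements on predecessors. *)
Lemma longest_rev u v z Q : longest u v z Q -> longest z v u (rev Q).
Proof.
have H a b s : hpath a v b s -> hpath b v a (rev s).
  case/andP=> us ws; rewrite /hpath (walk_rev e_sym ws) andbT.
  by move: us; rewrite /= rev_uniq mem_rev.
case=> hQ mQ; split=> [|Q' /H]; first exact: H.
by rewrite size_rev => /mQ; rewrite size_rev.
Qed.

(** [D] is a detour off [Q]; a walk using each vertex of [Q] and of [D] at most once inherits
    distinctness from [(v :: Q) ++ D]. *)
Lemma hpath_walk u v z (Q D Q' : seq T) : longest u v z Q -> uniq D ->
  {in D, forall w, w \notin v :: Q} ->
  walk e u z Q' -> (forall P, count P Q' <= count P Q + count P D) ->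
  hpath u v z Q'.
Proof.
move=> [/andP[uQ _] mQ] uD dQ wQ' cQ'; rewrite /hpath wQ' andbT.
apply: (@uniq_count_leq _ _ ((v :: Q) ++ D)).
  rewrite cat_uniq uQ uD andbT /=; apply/hasPn => w /dQ //.
by move=> P; rewrite /= count_cat; have := cQ' P; lia.
Qed.

Lemma longest_walk u v z (Q D Q' : seq T) : longest u v z Q -> uniq D ->
  {in D, forall w, w \notin v :: Q} ->
  walk e u z Q' -> (forall P, count P Q' <= count P Q + count P D) ->
  size Q' <= size Q.
Proof. by move=> lQ uD dQ wQ' cQ'; case: (lQ) => _; apply; apply: hpath_walk lQ uD dQ wQ' cQ'. Qed.

Lemma longest_ends u v z Q : longest u v z Q -> [/\ 0 < size Q, nth v Q 0 = u,
   nth v Q (size Q).-1 = z, uniq Q & v \notin Q].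
Proof.
case=> /andP[/= /andP[vQ uQ] /and4P[Q0 _ h l]] _.
rewrite lt0n size_eq0 Q0 uQ vQ nth_last nth0.
by case: Q Q0 h l {uQ vQ} => //= x s _ /eqP -> /eqP ->.
Qed.

Lemma longest_edge u v z Q i : longest u v z Q -> i.+1 < size Q ->
  e (nth v Q i) (nth v Q i.+1).
Proof.
case=> /andP[_ /and4P[_ sQ _ _]] _; move/(sortedP v): sQ; exact.
Qed.
End Longest.

(** Each pair [f p + g p.+1] is at most 1, and pairing the terms this way leaves only [g a] and
    [f b.-1] over. *)
Lemma cross_sum (f g : nat -> bool) a b : a < b ->
  (forall p, a <= p -> p.+1 < b -> f p -> ~~ g p.+1) ->
  \sum_(a <= p < b) (f p + g p) <= (b - a).-1 + g a + f b.-1.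
Proof.
elim: b => // b IH; rewrite ltnS leq_eqVlt => /predU1P[->|ab] fg.
  by rewrite big_nat1 subSnn /= addnC.
rewrite big_nat_recr ?(ltnW ab) //=.
have := IH ab (fun p ap pb => fg p ap (ltnW pb)).
have := fg b.-1; rewrite prednK; last by case: (b) ab.
move=> /(_ ltac:(lia) (leqnn _)).
by case: (f b.-1) => [/(_ isT)|_]; case: (g b) => //=; lia.
Qed.

(** * Components off a longest path and the crossing argument *)

Section Exchange.
Variables (T : finType) (e : rel T).
Hypotheses (e_sym : symmetric e) (e_irr : irreflexive e).

Definition outside (v : T) (Q : seq T) : {set T} := [set w | w \notin v :: Q].

Definition component (v : T) (Q : seq T) (a : T) : {set T} :=
  [set w | connect (induced_rel e (outside v Q)) a w].

Lemma outside_rev v Q : outside v (rev Q) = outside v Q.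
Proof. by apply/setP => w; rewrite !inE mem_rev. Qed.

Lemma component_rev v Q a : component v (rev Q) a = component v Q a.
Proof. by rewrite /component outside_rev. Qed.

Lemma component_outside v Q a b : a \in outside v Q -> b \in component v Q a -> b \in outside v Q.
Proof.
move=> aR; rewrite [b \in component _ _ _]inE => /connectP[q pq ->].
elim: q a aR pq => //= c q IH a aR /andP[/and3P[_ _ cR]]; exact: IH.
Qed.

Lemma component_refl v Q a : a \in component v Q a.
Proof. by rewrite inE connect0. Qed.

Lemma component_edge v Q a b c : b \in component v Q a -> e b c -> b \in outside v Q ->
  c \in outside v Q -> c \in component v Q a.
Proof.
rewrite ![_ \in component _ _ _]inE => ab bc bR cR; apply: connect_trans ab (connect1 _).
by apply/and3P; split.
Qed.

Lemma induced_sym (S : {set T}) : symmetric (induced_rel e S).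
Proof. by move=> p q; rewrite /induced_rel /= e_sym [(q \in S) && _]andbC. Qed.

Lemma component_trans v Q a b c : b \in component v Q a -> c \in component v Q a -> c \in component v Q b.
Proof.
rewrite !inE => ab; apply: connect_trans.
by rewrite (sym_connect_sym (@induced_sym _)).
Qed.

(** Supplies the detour to insert into [Q]. The last clause reads a boolean as a number: [D] has at
    least one vertex, and at least two when [a != b]. *)
Lemma component_walk v Q a b : a \in outside v Q -> b \in component v Q a ->
  exists D : seq T, [/\ walk e a b D, uniq D, {in D, forall w, w \notin v :: Q},
    {subset D <= component v Q a} & (a != b) < size D].
Proof.
move=> aR; rewrite inE => /connectP[q0 pq0 ->]; case/shortenP: pq0 => q pq uq _ {q0}.
have sD : {subset a :: q <= component v Q a}.
  by move=> w /(path_connect pq); rewrite inE.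
exists (a :: q); split=> //.
- by apply: walk_path; apply: sub_path pq => c d /and3P[].
- by move=> w /sD /(component_outside aR); rewrite inE.
- by case: q {pq uq sD} => [|c q] /=; [rewrite eqxx | case: eqP].
Qed.

Lemma deg_split (v s : T) (Q : seq T) : uniq (v :: Q) -> #|nbhd e s| =
  e s v + \sum_(0 <= p < size Q) e s (nth v Q p) + #|[set w in outside v Q | e s w]|.
Proof.
move=> uQ; rewrite -(cardsID [set w in v :: Q]); congr (_ + _); last first.
  by apply: eq_card => w; rewrite !inE andbC.
have -> : \sum_(0 <= p < size Q) e s (nth v Q p) = count (e s) Q.
  by rewrite -sum1_count [RHS]big_mkcond [RHS](big_nth v); apply: eq_bigr => p _; case: (e s _).
rewrite -[e s v + _]/(count (e s) (v :: Q)) -size_filter.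
rewrite -(card_uniqP (filter_uniq _ uQ)); apply: eq_card => w.
by rewrite !inE mem_filter inE.
Qed.

Lemma card_outside (v : T) (Q : seq T) : uniq (v :: Q) -> #|T| = (size Q).+1 + #|outside v Q|.
Proof.
move=> uQ; rewrite -(cardC (mem (v :: Q))) (card_uniqP uQ); congr (_ + _).
by apply: eq_card => w; rewrite !inE.
Qed.

Section Attach.
Variables (u v z : T) (Q : seq T).
Hypothesis lQ : longest e u v z Q.
Local Notation x := (nth v Q).
Local Notation m := (size Q).

Let sQ : sorted e Q. Proof. by case: lQ => /andP[_ /and4P[]]. Qed.
Let x0 : x 0 = u. Proof. by case: (longest_ends lQ). Qed.
Let xm : x m.-1 = z. Proof. by case: (longest_ends lQ). Qed.

Let wseg i j : i <= j -> j < m -> walk e (x i) (x j) (seg Q i j).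
Proof. exact: walk_seg. Qed.

Let cQ P i : i < m.-1 ->
  count P Q = count P (seg Q 0 i) + count P (seg Q i.+1 m.-1).
Proof. by move=> im; rewrite -(count_seg P Q) // seg_full. Qed.

(** The form in which maximality is used: a path made of exactly the vertices of [Q] and [D] would
    be longer by [size D]. *)
Let size_Q_extra (D Q' : seq T) : uniq D -> {in D, forall w, w \notin v :: Q} ->
  walk e u z Q' -> (forall P, count P Q' = count P Q + count P D) -> size D = 0.
Proof.
move=> uD dD wQ' cQ'; have := longest_walk lQ uD dD wQ' (fun P => eq_leq (cQ' P)).
by rewrite -(count_predT Q') cQ' !count_predT; nlia.
Qed.

Section Pair.
Variables (i j : nat) (a b : T).
Hypotheses (ij : i < j) (jm : j < m) (aR : a \in outside v Q) (ab : b \in component v Q a).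
Hypotheses (xa : e (x i) a) (xb : e (x j) b).

(** Otherwise replacing the vertices of [Q] strictly between [x i] and [x j] by a walk through the
    component gives a longer path. *)
Lemma attach_gap : i.+1 < j /\ (a != b -> i.+2 < j).
Proof.
have [D [wD uD dD _ D1]] := component_walk aR ab.
have w : walk e u z (seg Q 0 i ++ D ++ seg Q j m.-1).
  rewrite -x0 -xm; apply: walk_cat (wseg _ _) (walk_cat wD (wseg _ _) _) _; first [done | nlia | by rewrite e_sym].
have c2 P : i.+1 < j -> count P (seg Q i.+1 m.-1) =
    count P (seg Q i.+1 j.-1) + count P (seg Q j m.-1).
  by move=> h; rewrite (@count_seg _ P Q i.+1 j.-1) ?prednK //; nlia.
have szs k l : k <= l -> l < m -> size (seg Q k l) = l.+1 - k.
  by move=> kl lm; rewrite size_takel // size_drop; nlia.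
have := longest_walk lQ uD dD w; rewrite !size_cat !szs; try nlia.
have h : forall P, count P (seg Q 0 i ++ D ++ seg Q j m.-1) <= count P Q + count P D.
  move=> P; rewrite !count_cat (@cQ _ i); last nlia.
  case: (ltnP i.+1 j) => h; first by rewrite (c2 _ h); nlia.
  have -> : j = i.+1 by nlia.
  nlia.
by move/(_ h) => hs; split=> [|ab']; move: D1; rewrite ?ab'; nlia.
Qed.

(** An edge would give the longer path [x 0 .. x i], the detour, [x j] back to [x i.+1], then
    [x j.+1 .. z]. *)
Lemma succ_nonadj : j.+1 < m -> ~~ e (x i.+1) (x j.+1).
Proof.
move=> jm1; apply/negP => ss.
have [D [wD uD dD _ D1]] := component_walk aR ab; have [gij _] := attach_gap.
have w : walk e u z (seg Q 0 i ++ D ++ rev (seg Q i.+1 j) ++ seg Q j.+1 m.-1).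
  rewrite -x0 -xm; apply: walk_cat (wseg _ _) (walk_cat wD (walk_cat (walk_rev e_sym (wseg _ _)) (wseg _ _) _) _) _; first [done | nlia | by rewrite e_sym].
suff: size D = 0 by nlia.
apply: size_Q_extra uD dD w _ => P; rewrite !count_cat count_rev (@cQ _ i); last nlia.
by rewrite (@count_seg _ P Q i.+1 j m.-1); nlia.
Qed.

Hypothesis jm1 : j.+1 < m.

(** Both edges would give the longer path [x 0 .. x p], [x i.+1 .. x j], the detour reversed, [x i]
    back to [x p.+1], then [x j.+1 .. z]. *)
Lemma cross_low p : p < i -> e (x i.+1) (x p) -> ~~ e (x j.+1) (x p.+1).
Proof.
move=> pi sp; apply/negP => tp.
have [D [wD uD dD _ D1]] := component_walk aR ab; have [gij _] := attach_gap.
have w : walk e u z (seg Q 0 p ++ seg Q i.+1 j ++ rev D ++ rev (seg Q p.+1 i) ++ seg Q j.+1 m.-1).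
  rewrite -x0 -xm.
  apply: walk_cat (wseg _ _) (walk_cat (wseg _ _) (walk_cat (walk_rev e_sym wD)
    (walk_cat (walk_rev e_sym (wseg _ _)) (wseg _ _) _) _) _) _; first [done | nlia | by rewrite e_sym].
suff: size D = 0 by nlia.
apply: size_Q_extra uD dD w _ => P; rewrite !count_cat !count_rev (@cQ _ p); last nlia.
by rewrite (@count_seg _ P Q p.+1 i m.-1) ?(@count_seg _ P Q i.+1 j m.-1); nlia.
Qed.

(** Both edges would give the longer path [x 0 .. x i], the detour, [x j] back to [x p.+1],
    [x i.+1 .. x p], then [x j.+1 .. z]. *)
Lemma cross_mid p : i < p -> p < j -> e (x j.+1) (x p) -> ~~ e (x i.+1) (x p.+1).
Proof.
move=> ip pj tp; apply/negP => sp.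
have [D [wD uD dD _ D1]] := component_walk aR ab; have [gij _] := attach_gap.
have w : walk e u z (seg Q 0 i ++ D ++ rev (seg Q p.+1 j) ++ seg Q i.+1 p ++ seg Q j.+1 m.-1).
  rewrite -x0 -xm.
  apply: walk_cat (wseg _ _) (walk_cat wD (walk_cat (walk_rev e_sym (wseg _ _))
    (walk_cat (wseg _ _) (wseg _ _) _) _) _) _; first [done | nlia | by rewrite e_sym].
suff: size D = 0 by nlia.
apply: size_Q_extra uD dD w _ => P; rewrite !count_cat !count_rev (@cQ _ i); last nlia.
by rewrite (@count_seg _ P Q i.+1 p m.-1) ?(@count_seg _ P Q p.+1 j m.-1); nlia.
Qed.

(** Both edges would give the longer path [x 0 .. x i], the detour, [x j] back to [x i.+1], [x p]
    back to [x j.+1], then [x p.+1 .. z]. *)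
Lemma cross_high p : j < p -> p.+1 < m -> e (x i.+1) (x p) -> ~~ e (x j.+1) (x p.+1).
Proof.
move=> jp pm sp; apply/negP => tp.
have [D [wD uD dD _ D1]] := component_walk aR ab; have [gij _] := attach_gap.
have w : walk e u z (seg Q 0 i ++ D ++ rev (seg Q i.+1 j) ++ rev (seg Q j.+1 p) ++ seg Q p.+1 m.-1).
  rewrite -x0 -xm.
  apply: walk_cat (wseg _ _) (walk_cat wD (walk_cat (walk_rev e_sym (wseg _ _))
    (walk_cat (walk_rev e_sym (wseg _ _)) (wseg _ _) _) _) _) _; first [done | nlia | by rewrite e_sym].
suff: size D = 0 by nlia.
apply: size_Q_extra uD dD w _ => P; rewrite !count_cat !count_rev (@cQ _ i); last nlia.
by rewrite (@count_seg _ P Q i.+1 j m.-1) ?(@count_seg _ P Q j.+1 p m.-1); nlia.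
Qed.

(** The path of [succ_nonadj], with [w] inserted between [x i.+1] and [x j.+1]; [w] must not be on
    the detour already. *)
Lemma cross_outside w : w \in outside v Q -> w \notin component v Q a ->
  e (x i.+1) w -> ~~ e (x j.+1) w.
Proof.
move=> wR wC sw; apply/negP => tw.
have [D [wD uD dD sD D1]] := component_walk aR ab; have [gij _] := attach_gap.
have wk : walk e u z (seg Q 0 i ++ D ++ rev (seg Q i.+1 j) ++ [:: w] ++ seg Q j.+1 m.-1).
  rewrite -x0 -xm.
  apply: walk_cat (wseg _ _) (walk_cat wD (walk_cat (walk_rev e_sym (wseg _ _))
    (walk_cat (walk1 _ _) (wseg _ _) _) _) _) _; first [done | nlia | by rewrite e_sym].
have uDw : uniq (w :: D) by rewrite /= uD andbT; apply: contra wC; exact: sD.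
have dDw : {in w :: D, forall y, y \notin v :: Q}.
  by move=> y; rewrite inE => /predU1P[->|/dD//]; move: wR; rewrite inE.
suff: size (w :: D) = 0 by [].
apply: size_Q_extra uDw dDw wk _ => P; rewrite !count_cat !count_rev (@cQ _ i); last nlia.
by rewrite (@count_seg _ P Q i.+1 j m.-1) /=; nlia.
Qed.

End Pair.

Lemma succ_notin_component i a w : i.+1 < m -> a \in outside v Q -> e (x i) a ->
  w \in component v Q a -> ~~ e (x i.+1) w.
Proof.
move=> im aR xa wC; apply/negP => sw.
by have [] := attach_gap (ltnSn i) im aR wC xa sw; rewrite ltnn.
Qed.

(* Both successors lie outside the neighbourhood of the component, and crossing
   edges are excluded on each of the segments [0..i], [i+1..j], [j+1..m-1]. *)
Lemma succ_deg_sum k i j a b : i < j -> j.+1 < m -> a \in outside v Q ->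
  b \in component v Q a -> e (x i) a -> e (x j) b -> k_regular e k ->
  k.*2 + #|component v Q a| + 1 <= #|T| + e (x i.+1) v + e (x j.+1) v + e (x i.+1) z.
Proof.
move=> ij jm1 aR ab xa xb reg; have jm := ltnW jm1.
have [gij _] := attach_gap ij jm aR ab xa xb.
set s := x i.+1; set t := x j.+1.
have I : \sum_(0 <= p < i.+1) (e s (x p) + e t (x p)) <= i.+2.
  have := @cross_sum (fun p => e s (x p)) (fun p => e t (x p)) 0 i.+1 isT.
  have h p : 0 <= p -> p.+1 < i.+1 -> e s (x p) -> ~~ e t (x p.+1).
    by move=> _; rewrite ltnS; apply: (cross_low ij jm aR ab xa xb jm1).
  by move/(_ h); case: (e t _); case: (e s _) => /=; nlia.
have J : \sum_(i.+1 <= p < j.+1) (e s (x p) + e t (x p)) <= j - i.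
  have := @cross_sum (fun p => e t (x p)) (fun p => e s (x p)) i.+1 j.+1.
  have h p : i.+1 <= p -> p.+1 < j.+1 -> e t (x p) -> ~~ e s (x p.+1).
    by rewrite !ltnS => ip pj; apply: (cross_mid ij jm aR ab xa xb jm1).
  move/(_ ltac:(nlia) h); rewrite /= [e s s]e_irr.
  under eq_bigr do rewrite addnC.
  by case: (e t _) => /=; nlia.
have K : \sum_(j.+1 <= p < m) (e s (x p) + e t (x p)) <= (m - j.+2) + e s z.
  have := @cross_sum (fun p => e s (x p)) (fun p => e t (x p)) j.+1 m jm1.
  have h p : j.+1 <= p -> p.+1 < m -> e s (x p) -> ~~ e t (x p.+1).
    by move=> jp pm; apply: (cross_high ij jm aR ab xa xb jm1).
  by move/(_ h); rewrite [e t t]e_irr xm; case: (e s z) => /=; nlia.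
(* Off the path, [s] and [t] have no common neighbour by [cross_outside], and neither has one in the
   component by [succ_notin_component]. *)
have O : #|[set w in outside v Q | e s w]| + #|[set w in outside v Q | e t w]|
    + #|component v Q a| <= #|outside v Q|.
  rewrite -cardsUI (_ : _ :&: _ = set0) ?cards0 ?addn0; last first.
    apply/setP => w; rewrite in_set0 !inE; apply/negP => /andP[/andP[wR sw] /andP[_ tw]].
    have wR' : w \in outside v Q by rewrite inE.
    have [wC|wC] := boolP (w \in component v Q a).
      have im : i.+1 < m by nlia.
      by have := succ_notin_component im aR xa wC; rewrite sw.
    by have := cross_outside ij jm aR ab xa xb jm1 wR' wC sw; rewrite tw.
  rewrite -cardsUI (_ : _ :&: _ = set0) ?cards0 ?addn0; last first.
    apply/setP => w; rewrite [RHS]inE; apply/negP => /setIP[st wC].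
    have im : i.+1 < m by nlia.
    have := succ_notin_component im aR xa wC.
    have := succ_notin_component jm1 (component_outside aR ab) xb (component_trans ab wC).
    by move: st; rewrite !inE => /orP[] /andP[_ ->].
  apply/subset_leq_card/subsetP => w /setUP[|/(component_outside aR)//].
  by rewrite !inE => /orP[] /andP[].
have uQ : uniq (v :: Q) by case: lQ => /andP[].
have sm : \sum_(0 <= p < m) (e s (x p) + e t (x p)) <= m + e s z.
  have [im ij1] : i.+1 <= m /\ i.+1 <= j.+1 by split; nlia.
  rewrite (@big_cat_nat _ _ _ i.+1) // (@big_cat_nat _ _ _ j.+1 i.+1) //=.
  apply: leq_trans (leq_add I (leq_add J K)) _.
  by move: (e s z : nat) => c; nlia.
move: sm (deg_split s uQ) (deg_split t uQ) (card_outside uQ).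
rewrite big_split /= !reg; move: (\sum_(_ <= _ < _) _) (\sum_(_ <= _ < _) _) => S1 S2.
move: O (e s v : nat) (e t v : nat) (e s z : nat).
move: #|_| #|_| #|_| #|_| #|_| => *; nlia.
Qed.

End Attach.
End Exchange.

(** * Degree counts in a regular graph *)

Section Counting.
Variables (T : finType) (e : rel T) (k : nat).
Hypotheses (e_sym : symmetric e) (e_irr : irreflexive e) (reg : k_regular e k).

Definition deg_in (S : {set T}) (w : T) : nat := #|nbhd e w :&: S|.

Lemma deg_in_split S w : deg_in S w + deg_in (~: S) w = k.
Proof. by rewrite /deg_in -setDE cardsID reg. Qed.

Lemma deg_in_sum S w : deg_in S w = \sum_(p in S) e w p.
Proof.
rewrite /deg_in -sum1_card (eq_bigl (fun p => (p \in S) && e w p)).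
  by rewrite big_mkcondr; apply: eq_bigr => p _; case: (e w p).
by move=> p; rewrite !inE andbC.
Qed.

(** The edges between [X] and its complement are counted from both sides; on each side their number
    is [k] times the size minus the inner degree sum. *)
Lemma deg_in_compl (X : {set T}) :
  \sum_(w in ~: X) deg_in (~: X) w + k * #|X| =
  k * #|~: X| + \sum_(w in X) deg_in X w.
Proof.
have H (S : {set T}) : \sum_(w in S) deg_in S w + \sum_(w in S) deg_in (~: S) w = k * #|S|.
  by rewrite -big_split /= mulnC -sum_nat_const; apply: eq_bigr => w _; rewrite deg_in_split.
have E : \sum_(w in X) deg_in (~: X) w = \sum_(w in ~: X) deg_in X w.
  under eq_bigr do rewrite deg_in_sum.
  rewrite exchange_big /=; apply: eq_bigr => w _; rewrite deg_in_sum.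
  by apply: eq_bigr => p _; rewrite e_sym.
have := H X; have := H (~: X); rewrite setCK -E; nlia.
Qed.

Lemma deg_in_indep (Y : {set T}) : independent e Y -> \sum_(w in Y) deg_in Y w = 0.
Proof.
move=> iY; apply: big1 => w wY; apply/eqP; rewrite cards_eq0; apply/eqP/setP => p.
by rewrite !inE; apply/negP => /andP[wp pY]; have := iY w p wY pY; rewrite wp.
Qed.

(** All [k * #|Y|] edges at [Y] end in the complement, which takes at most [k * #|~: Y|]; so [Y] has
    at most half of the vertices. *)
Lemma independent_card (Y : {set T}) : 0 < k -> #|T| <= k.*2.+1 ->
  independent e Y -> #|Y| <= k.
Proof.
move=> k0 nk iY; have := deg_in_compl (~: Y); rewrite setCK deg_in_indep // => h.
have : k * #|Y| <= k * #|~: Y| by nlia.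
by rewrite leq_pmul2l // => h2; have := cardsC Y; nlia.
Qed.

Lemma even_degree_sum : ~~ odd (k * #|T|).
Proof.
have -> : k * #|T| = \sum_(p : T) \sum_(q : T) e p q.
  rewrite mulnC -sum_nat_const; apply: eq_bigr => p _; rewrite -(reg p).
  have := deg_in_sum setT p; rewrite /deg_in setIT => ->.
  by apply: eq_bigl => q; rewrite inE.
(* [enum_rank] orders the vertices, so that the inner sum counts each edge from one end only. *)
have -> : \sum_(p : T) \sum_(q : T) e p q =
    (\sum_(p : T) \sum_(q : T | enum_rank p < enum_rank q) e p q).*2.
  have E : \sum_(p : T) \sum_(q : T | enum_rank p < enum_rank q) e p q =
      \sum_(p : T) \sum_(q : T | enum_rank q < enum_rank p) e p q.
    rewrite (exchange_big_dep xpredT) //=.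
    by apply: eq_bigr => q _; apply: eq_bigr => p _; rewrite e_sym.
  rewrite -addnn {2}E.
  rewrite -big_split /=; apply: eq_bigr => p _.
  rewrite [LHS](bigID (fun q : T => enum_rank p < enum_rank q)) /=; congr (_ + _).
  rewrite [LHS](bigID (pred1 p)) /= [X in X + _]big1 ?add0n.
    by apply: eq_bigl => q; rewrite -leqNgt ltn_neqAle andbC (inj_eq val_inj) (inj_eq enum_rank_inj).
  by move=> q /andP[_ /eqP->]; rewrite e_irr.
by rewrite odd_double.
Qed.

Lemma connected_closed (S D : {set T}) (a : T) : connected_on e S -> a \in S -> a \in D ->
  (forall p q, p \in S -> q \in S -> p \in D -> e p q -> q \in D) -> S \subset D.
Proof.
move=> cS aS aD cl; apply/subsetP => w /(cS a w aS) /connectP[q + ->] {w}.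
elim: q a aS aD => //= c q IH a aS aD /andP[/and3P[ac _ cS']]; apply: IH => //.
exact: cl ac.
Qed.
End Counting.

(** * The standing hypotheses, and where a component is attached to the path *)

Section Setting.
Variables (T : finType) (e : rel T) (k : nat).

(** Bundled so that the symmetry between [u] and [z] applies in one step. *)
Definition setting (u v z : T) : Prop :=
  [/\ simple_graph e, two_connected e, k_regular e k & #|T| <= k.*2.+1] /\
  [/\ [/\ u != v, v != z & u != z], e u v, e v z,
      connected_on e (~: [set u; v; z]) & ~ in_classH e k u v z].

Lemma setting_sym u v z : setting u v z -> setting z v u.
Proof.
move=> [[sg tc reg nk] [[uv vz uz] euv evz c3 nH]]; have [es _] := sg.
have E : [set z; v; u] = [set u; v; z].
  by apply/setP => w; rewrite !inE; case: (w == u); case: (w == v); case: (w == z).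
split; split=> //; first by split; rewrite eq_sym.
- by rewrite es.
- by rewrite es.
- by rewrite E.
case=> q [kq tc' reg' nq [X [Y [dXY iY sX cY [cX nY evz' evu]]]]].
by apply: nH; exists q; split=> //; exists X, Y; rewrite -E; split.
Qed.

Section Consequences.
Variables (u v z : T).
Hypothesis G : setting u v z.
Let e_sym : symmetric e. Proof. by case: G => [[[]]]. Qed.
Let e_irr : irreflexive e. Proof. by case: G => [[[]]]. Qed.
Let reg : k_regular e k. Proof. by case: G => [[]]. Qed.
Let nk : #|T| <= k.*2.+1. Proof. by case: G => [[]]. Qed.
Let uv : u != v. Proof. by case: G => [_ [[]]]. Qed.
Let vz : v != z. Proof. by case: G => [_ [[]]]. Qed.
Let uz : u != z. Proof. by case: G => [_ [[]]]. Qed.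
Let euv : e u v. Proof. by case: G => [_ []]. Qed.
Let evz : e v z. Proof. by case: G => [_ []]. Qed.

Lemma setting_k2 : 1 < k.
Proof.
rewrite -(reg v); have -> : 2 = #|[set u; z]| by rewrite cards2 uz.
by apply/subset_leq_card/subsetP => w; rewrite !inE => /orP[] /eqP-> //; rewrite e_sym.
Qed.

(** The size is at most [k] by counting. If it were [k], then [n <= 2k] would leave no edge in the
    complement, which contains [uv], and [n = 2k + 1] would make [Y] and its complement a witness of
    the class H with [q = k]. *)
Lemma independent_avoiding_card (Y : {set T}) : independent e Y ->
  u \notin Y -> v \notin Y -> z \notin Y -> #|Y| < k.
Proof.
move=> iY uY vY zY; have k0 : 0 < k by apply: ltn_trans setting_k2.
have := independent_card e_sym reg k0 nk iY; rewrite leq_eqVlt => /predU1P[Yk|//].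
have := deg_in_compl e_sym reg (~: Y); rewrite setCK deg_in_indep // Yk => h.
have cC : #|~: Y| + k = #|T| by rewrite -Yk addnC cardsC.
have := nk; rewrite leq_eqVlt => /predU1P[n2|]; last first.
  rewrite ltnS => n2.
  have : 0 < \sum_(w in ~: Y) deg_in e (~: Y) w.
    rewrite (bigD1 u) ?inE //= addn_gt0 /deg_in.
    by apply/orP; left; apply/card_gt0P; exists v; rewrite !inE euv.
  have : k * #|~: Y| <= k * k by rewrite leq_mul2l; apply/orP; right; nlia.
  by nlia.
case: G => [[sg tc _ _] [_ _ _ _ []]]; exists k; split=> //.
exists (~: Y), Y; split=> //.
- by rewrite -setI_eq0 setIC setICr.
- by apply/subsetP => w; rewrite !inE -orbA => /or3P[] /eqP->.
split=> //; [by apply: (@addIn k); rewrite cC n2 -addnn | | by rewrite e_sym].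
apply/subsetP => w; rewrite !inE => /existsP[p /andP[pY pw]].
by apply/negP => wY; have := iY p w pY wY; rewrite pw.
Qed.

Variable Q : seq T.
Hypothesis lQ : longest e u v z Q.

Definition attach (a : T) : {set T} := [set w in Q | [exists b in component e v Q a, e w b]].

Let uQ : u \in Q.
Proof. by have [m0 <- _ _ _] := longest_ends lQ; apply: mem_nth. Qed.
Let zQ : z \in Q.
Proof. by have [m0 _ <- _ _] := longest_ends lQ; apply: mem_nth; rewrite prednK. Qed.

Lemma component_nbr a b w : a \in outside v Q -> b \in component e v Q a -> e b w -> w != v ->
  w \notin attach a -> w \in component e v Q a.
Proof.
move=> aR bC bw wv; have bR := component_outside aR bC; rewrite inE negb_and.
have [wQ /= /existsP[]|wQ _] := boolP (w \in Q); first by exists b; rewrite bC e_sym.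
by apply: component_edge bC bw bR _; rewrite !inE (negPf wv).
Qed.

Lemma component_notin_Q a w : a \in outside v Q -> w \in component e v Q a -> (w != v) && (w \notin Q).
Proof. by move=> aR /(component_outside aR); rewrite !inE negb_or. Qed.

(** Otherwise the connectivity of [G - {u, v, z}] puts all its vertices into the component, so [Q]
    is the single edge [uz]. Then [k = 2] and the triangle on [u], [v], [z] is cut off from the
    rest, against the connectivity of [G]. *)
Lemma attach_notin_ends a : a \in outside v Q ->
  exists w, [/\ w \in attach a, w != u & w != z].
Proof.
move=> aR.
suff /existsP[w /and3P[*]] : [exists w, [&& w \in attach a, w != u & w != z]] by exists w.
apply: contraT => /existsPn nE.
have Nuz w : w \in attach a -> (w == u) || (w == z).
  by move=> wN; have := nE w; rewrite wN /= -negb_or negbK.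
set D := component e v Q a in nE *.
have aD : a \in D by apply: component_refl.
have DQ w : w \in D -> (w != v) && (w \notin Q) by apply: component_notin_Q.
have sub : ~: [set u; v; z] \subset D.
  apply: (@connected_closed _ e _ D a); first by case: G => [_ []].
  - have /andP[av aQ] := DQ a aD; rewrite !inE (negPf av) orbF.
    by apply/norP; split; apply: contraNneq aQ => ->.
  - exact: aD.
  move=> p q pS qS pD pq; apply: (component_nbr aR pD pq).
    by apply: contraTneq qS => ->; rewrite !inE eqxx orbT.
  by apply: contraTN qS => /Nuz; rewrite !inE => /orP[] ->; rewrite ?orbT.
have cov w : w \in Q -> (w == u) || (w == z).
  move=> wQ; apply: contraTT wQ => wuz; have [->|wv] := eqVneq w v.
    by case: (longest_ends lQ).
  have wD : w \in D by apply: (subsetP sub); rewrite !inE (negPf wv) orbF.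
  by case/andP: (DQ w wD).
have [m0 x0 xm uniqQ vQ] := longest_ends lQ.
have m2 : size Q = 2.
  have szQ : size Q <= 2.
    have -> : 2 = size [:: u; z] by [].
    by apply: uniq_leq_size => // w /cov; rewrite !inE.
  have : size Q != 1 by apply: contraNneq uz => s1; rewrite -x0 -xm s1.
  by move: szQ m0; case: (size Q) => [|[|[]]].
have x1 : nth v Q 1 = z by rewrite -xm m2.
have euz : e u z by rewrite -x0 -x1; apply: longest_edge lQ _; rewrite m2.
(* By [attach_gap], consecutive vertices of [Q] are not both attachments. *)
have nuz : ~~ ((u \in attach a) && (z \in attach a)).
  apply/andP => -[]; rewrite !inE => /andP[_ /existsP[b /andP[bC ub]]].
  move=> /andP[_ /existsP[c /andP[cC zc]]].
  have := @attach_gap _ e e_sym u v z Q lQ 0 1 b c isT _ (component_outside aR bC) (component_trans e_sym bC cC).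
  by rewrite m2 x0 x1 => /(_ isT ub zc) [].
have nb w p : w \in [:: u; z] -> w \notin attach a -> e w p -> p \in [:: u; v; z].
  move=> wuz wN wp; apply: contraR wN => pn; rewrite inE.
  have -> : w \in Q by move: wuz; rewrite !inE => /orP[] /eqP->.
  apply/existsP; exists p; rewrite wp andbT; apply: (subsetP sub).
  by move: pn; rewrite !inE !negb_or -!andbA.
(* An end of [Q] that is no attachment has neighbours only among the other two of [u], [v], [z]. *)
have k2 : k = 2.
  apply/eqP; rewrite eqn_leq setting_k2 andbT.
  have [w [wuz wN]] : exists w, w \in [:: u; z] /\ w \notin attach a.
    by move: nuz; rewrite negb_and => /orP[] ?; [exists u | exists z]; split; rewrite // in_cons ?mem_head ?eqxx ?orbT.
  have [p [q sub2]] : exists p q, nbhd e w \subset [set p; q].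
    have nbw p : p \in nbhd e w -> p != w /\ p \in [:: u; v; z].
      rewrite inE => wp; split; last exact: nb wp.
      by apply: contraTneq wp => ->; rewrite e_irr.
    move: wuz nbw; rewrite !inE => /orP[] /eqP-> nbw; [exists v, z | exists u, v];
    by apply/subsetP => p /nbw; rewrite !inE => -[/negPf ->] //=; rewrite ?orbF.
  rewrite -(reg w) (leq_trans (subset_leq_card sub2)) // cards2.
  by case: (p != q).
have full w p q r : e w p -> e w q -> p != q -> e w r -> (r == p) || (r == q).
  move=> wp wq pq wr; have : [set p; q] \subset nbhd e w.
    by apply/subsetP => t; rewrite !inE => /orP[] /eqP->.
  move/subset_leqif_cards/leqifP; rewrite reg k2 cards2 pq.
  case: eqP => // E _; have : r \in nbhd e w by rewrite inE.
  by rewrite -E !inE.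
(* The triangle uses up the degree 2 of [u], [v] and [z], so [D] is closed under adjacency in the
   whole graph. *)
have : [set: T] \subset D.
  apply: (@connected_closed _ e _ D a); rewrite ?inE //; first by case: G => [[_ []]] [_ []].
  move=> p q _ _ pD pq; have /andP[pv pQ] := DQ p pD; apply: (component_nbr aR pD pq).
    apply: contraNneq pQ => qv; move: pq; rewrite qv e_sym => vp.
    by have := full v u z p; rewrite e_sym euv evz uz vp => /(_ isT isT isT isT) /orP[] /eqP->.
  apply: contra pQ; rewrite e_sym in pq; move=> /Nuz /orP[] /eqP qE; rewrite {q}qE in pq.
    have := full u v z p; rewrite euv euz vz pq => /(_ isT isT isT isT).
    by rewrite (negPf pv) => /eqP->.
  have := full z v u p; rewrite e_sym evz e_sym euz eq_sym uv pq => /(_ isT isT isT isT).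
  by rewrite (negPf pv) => /eqP->.
by move/subsetP/(_ v (in_setT _))/DQ; rewrite eqxx.
Qed.

(** If [c] were the only attachment, [v] and [c] would separate the component [D] from the rest [B],
    which contains [u] and [z]; then [v] and [c] have too few edges for the degrees on both
    sides. *)
Lemma attach_not_single a c : a \in outside v Q -> c \in attach a -> c != u -> c != z ->
  exists2 w, w \in attach a & w != c.
Proof.
move=> aR cN cu cz.
suff /existsP[w /andP[*]] : [exists w, (w \in attach a) && (w != c)] by exists w.
apply: contraT => /existsPn nE.
have Nc w : w \in attach a -> w = c.
  by move=> wN; apply/eqP; have := nE w; rewrite wN negbK.
set D := component e v Q a in nE *.
have aD : a \in D by apply: component_refl.
have DQ w : w \in D -> (w != v) && (w \notin Q) by apply: component_notin_Q.
have cQ : c \in Q by move: cN; rewrite inE => /andP[].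
have vQ : v \notin Q by case: (longest_ends lQ).
have cv : c != v by apply: contraNneq vQ => <-.
have vD : v \notin D by apply/negP => /DQ; rewrite eqxx.
have cD : c \notin D by apply/negP => /DQ; rewrite cQ andbF.
have Dcl p q : p \in D -> e p q -> q != v -> q != c -> q \in D.
  by move=> pD pq qv qc; apply: (component_nbr aR pD pq) => //; apply: contraNN qc => /Nc ->.
clearbody D; set B := ~: (v |: (c |: D)).
have uB : u \in B.
  rewrite !inE !negb_or uv eq_sym cu /=; apply/negP => /DQ; by rewrite uQ andbF.
have zB : z \in B.
  rewrite !inE !negb_or eq_sym vz eq_sym cz /=; apply/negP => /DQ; by rewrite zQ andbF.
have Bcl p q : p \in B -> e p q -> q != v -> q != c -> q \in B.
  rewrite !inE !negb_or => /and3P[pv pc pD] pq -> -> /=.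
  by apply: contra pD => qD; apply: (Dcl q p) => //; rewrite e_sym.
have cardn : #|D| + #|B| + 2 = #|T|.
  by have := cardsC (v |: (c |: D)); rewrite -/B !cardsU1 cD in_setU1 negb_or vD eq_sym cv /=; nlia.
(* For either side [S]: a vertex has at most [#|S| - 1] neighbours inside [S], and besides these
   only [v] and [c]. *)
have degD p (S : {set T}) : (forall q, p \in S -> e p q -> q != v -> q != c -> q \in S) ->
    p \in S -> k + ~~ e p v + ~~ e p c <= #|S|.+1.
  move=> Scl pS.
  have sub : nbhd e p \subset [set q in [:: v] | e p q] :|: [set q in [:: c] | e p q] :|: S :\ p.
    apply/subsetP => q; rewrite !inE => pq; rewrite pq !andbT.
    have [//|qv] := eqVneq q v; have [//|qc] := eqVneq q c.
    by rewrite (Scl q) // andbT; apply: contraTneq pq => ->; rewrite e_irr.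
  have one t : #|[set q in [:: t] | e p q]| = e p t.
    have [pt|pt] := boolP (e p t).
      by rewrite -[RHS](cards1 t); apply: eq_card => q; rewrite !inE; case: eqP => //= ->; rewrite pt.
    by apply: eq_card0 => q; rewrite !inE; case: eqP => //= ->; rewrite (negPf pt).
  have := subset_leq_card sub; rewrite reg => h.
  have := leq_trans h (leq_trans (leq_card_setU _ _) (leq_add (leq_card_setU _ _) (leqnn _))).
  rewrite !one (cardsD1 p S) pS; by case: (e p v); case: (e p c) => /=; nlia.
(* If [#|D| < k], every vertex of [D] is adjacent to [v], as are [u] and [z], so [#|D| + 2 <= k];
   but a degree in [D] is at most [#|D| + 1]. *)
have kD : k <= #|D|.
  rewrite leqNgt; apply/negP => Dk.
  have sub : D :|: [set u; z] \subset nbhd e v.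
    apply/subsetP => p; rewrite !inE => /orP[pD|/orP[] /eqP->//]; last by rewrite e_sym.
    by rewrite e_sym; apply: contraTT Dk => pv; have := degD p D (fun q => Dcl p q) pD; rewrite pv; nlia.
  have := subset_leq_card sub; rewrite reg cardsU cards2 uz.
  rewrite (_ : _ :&: _ = set0) ?cards0; last first.
    apply/setP => p; rewrite !inE; apply/negP => /andP[/DQ /andP[_ pQ]] /orP[] /eqP pE;
    by rewrite pE ?uQ ?zQ in pQ.
  have := degD a D (fun q => Dcl a q) aD; nlia.
(* Now [#|B| <= k - 1], so a vertex of [B] reaches degree [k] only with both [v] and [c]. *)
have degB p : p \in B -> e p v && e p c.
  move=> pB; have := degD p B (fun q => Bcl p q) pB; move: cardn kD nk.
  by case: (e p v); case: (e p c) => //=; nlia.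
have B2 : 1 < #|B|.
  rewrite (cardsD1 u) uB ltnS; apply/card_gt0P; exists z.
  by rewrite !inE eq_sym uz; move: zB; rewrite !inE.
have few t : (forall p, p \in B -> e p t) -> #|[set p in D | e t p]| + #|B| <= k.
  move=> tB; rewrite -cardsUI (_ : _ :&: B = set0) ?cards0 ?addn0 -1?(reg t).
    apply/subset_leq_card/subsetP => p /setUP[|/tB tp]; rewrite !inE; first by case/andP.
    by rewrite e_sym.
  by apply/setP => p; rewrite !inE; case: (p \in D); rewrite ?orbT ?andbF.
have fv : #|[set p in D | e v p]| + #|B| <= k by apply: few => p /degB /andP[].
have fc : #|[set p in D | e c p]| + #|B| <= k by apply: few => p /degB /andP[].
have uBk := degD u B (fun q => Bcl u q) uB.
(* Since [#|B| >= k - 1], also [#|D| <= k], so each vertex of [D] needs [v] or [c]. *)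
have cov : D \subset [set p in D | e v p] :|: [set p in D | e c p].
  apply/subsetP => p pD; rewrite !inE pD /= (e_sym v) (e_sym c).
  have := degD p D (fun q => Dcl p q) pD; move: cardn uBk nk.
  by case: (e p v); case: (e p c) => //=; nlia.
(* Adding [fv] and [fc] gives [#|D| + 2 * #|B| <= 2 * k], against [#|D| >= k], [#|B| >= k - 1] and
   [#|B| >= 2]. *)
have := leq_trans (subset_leq_card cov) (leq_card_setU _ _).
move: fv fc uBk B2 kD cardn nk; move: #|_| #|_| #|_| #|_| #|_| => *; nlia.
Qed.
End Consequences.
End Setting.

(** * Successors and predecessors on the path *)

Section Shift.
Variables (T : finType).
Implicit Types Q : seq T.

(* Both maps are constant at the end they cannot leave: the ends of [Q] are
   neighbours of [v], so they may stand in for the missing successor. *)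
Definition next_on (Q : seq T) (w : T) : T := nth w Q (minn (index w Q).+1 (size Q).-1).

Definition prev_on (Q : seq T) (w : T) : T := nth w Q (index w Q).-1.

Lemma next_on_nth v Q i : uniq Q -> i < size Q ->
  next_on Q (nth v Q i) = nth v Q (minn i.+1 (size Q).-1).
Proof. by move=> uQ im; rewrite /next_on index_uniq //; apply: set_nth_default; nlia. Qed.

Lemma prev_on_nth v Q i : uniq Q -> i < size Q ->
  prev_on Q (nth v Q i) = nth v Q i.-1.
Proof. by move=> uQ im; rewrite /prev_on index_uniq //; apply: set_nth_default; nlia. Qed.

Lemma prev_on_rev Q w : uniq Q -> w \in Q -> prev_on Q w = next_on (rev Q) w.
Proof.
move=> uQ wQ; have im : index w Q < size Q by rewrite index_mem.
set j := size Q - (index w Q).+1.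
have jm : j < size Q by rewrite /j; nlia.
have E : nth w (rev Q) j = w.
  rewrite nth_rev //; have -> : size Q - j.+1 = index w Q by rewrite /j; nlia.
  exact: nth_index.
have j1 : minn j.+1 (size Q).-1 < size Q by nlia.
rewrite -[w in RHS]E (next_on_nth w) ?rev_uniq ?size_rev // nth_rev // /prev_on.
by congr nth; rewrite /j; nlia.
Qed.

Lemma card_pair_filter (P : pred T) (p q : T) : p != q ->
  #|[set w in [:: p; q] | P w]| = P p + P q.
Proof.
move=> pq; have H r : #|[set w in [:: r] | P w]| = P r.
  have [Pr|Pr] := boolP (P r).
    by rewrite -[RHS](cards1 r); apply: eq_card => w; rewrite !inE; case: eqP => //= ->.
  by apply: eq_card0 => w; rewrite !inE; case: eqP => //= ->; rewrite (negPf Pr).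
rewrite -!H -cardsUI [X in _ = _ + X](_ : _ = 0) ?addn0.
  by apply: eq_card => w; rewrite !inE andb_orl.
apply: eq_card0 => w; rewrite !inE; apply/negP => /andP[/andP[/eqP-> _] /andP[pq' _]].
by rewrite pq' in pq.
Qed.
End Shift.

(** * Successors of attachments that are not adjacent to [v] *)

Section Component.
Variables (T : finType) (e : rel T) (k : nat).
Variables (u v z : T) (Q : seq T).
Hypotheses (G : setting e k u v z) (lQ : longest e u v z Q).
Let e_sym : symmetric e. Proof. by case: G => [[[]]]. Qed.
Let e_irr : irreflexive e. Proof. by case: G => [[[]]]. Qed.
Let reg : k_regular e k. Proof. by case: G => [[]]. Qed.
Let uz : u != z. Proof. by case: G => [_ [[]]]. Qed.
Let evz : e v z. Proof. by case: G => [_ []]. Qed.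
Local Notation x := (nth v Q).
Local Notation m := (size Q).
Let uniqQ : uniq Q. Proof. by case: (longest_ends lQ). Qed.
Let x0 : x 0 = u. Proof. by case: (longest_ends lQ). Qed.
Let xm : x m.-1 = z. Proof. by case: (longest_ends lQ). Qed.
Let m0 : 0 < m. Proof. by case: (longest_ends lQ). Qed.
Let m1 : 1 < m.
Proof.
by rewrite ltn_neqAle m0 andbT eq_sym; apply: contraNneq uz => s1; rewrite -x0 -xm s1.
Qed.

Let x_inj i j : i < m -> j < m -> x i = x j -> i = j.
Proof. by move=> im jm /eqP; rewrite nth_uniq // => /eqP. Qed.

Let xQ w : w \in Q -> exists2 i, i < m & w = x i.
Proof. by move=> wQ; exists (index w Q); rewrite ?index_mem ?nth_index. Qed.

Variable a : T.
Hypothesis aR : a \in outside v Q.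
Local Notation D := (component e v Q a).
Local Notation N := (attach e v Q a).

Lemma attachP w : reflect (exists i b, [/\ i < m, w = x i, b \in D & e (x i) b]) (w \in N).
Proof.
apply: (iffP idP) => [|[i [b [im -> bD xb]]]]; rewrite inE.
  by case/andP => /xQ[i im ->] /existsP[b /andP[bD xb]]; exists i, b.
by rewrite mem_nth //=; apply/existsP; exists b; rewrite bD.
Qed.

Lemma attach_index_gap i j b c : i < j -> j < m -> b \in D -> c \in D ->
  e (x i) b -> e (x j) c -> i.+1 < j /\ (b != c -> i.+2 < j).
Proof.
move=> ij jm bD cD; apply: (attach_gap e_sym lQ) => //; first exact: component_outside bD.
exact: component_trans bD cD.
Qed.

Lemma attach_nth_gap i j : i < j -> j < m -> x i \in N -> x j \in N -> i.+1 < j.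
Proof.
move=> ij jm /attachP[i' [b [im' /x_inj ii' bD xb]]] /attachP[j' [c [jm' /x_inj jj' cD xc]]].
have [E1 E2] : i = i' /\ j = j' by split; [apply: ii' | apply: jj'] => //; nlia.
by rewrite -E1 in xb; rewrite -E2 in xc; case: (attach_index_gap ij jm bD cD xb xc).
Qed.

(** [succ_deg_sum] with its last term replaced: when [x j.+1] is [z], it is itself the successor of
    an attachment and so not adjacent to [x i.+1]. *)
Lemma attach_succ_deg i j : i < j -> j.+1 < m -> x i \in N -> x j \in N ->
  k.*2 + #|D| + 1 <= #|T| + e v (x i.+1) + e v (x j.+1) + (j.+2 < m).
Proof.
move=> ij jm1 /attachP[i' [b [im' /x_inj ii' bD xb]]] /attachP[j' [c [jm' /x_inj jj' cD xc]]].
have [E1 E2] : i = i' /\ j = j' by split; [apply: ii' | apply: jj'] => //; nlia.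
rewrite -E1 in xb; rewrite -E2 in xc.
have bR := component_outside aR bD; have bc := component_trans e_sym bD cD.
have jm := ltnW jm1.
have DE : #|D| = #|component e v Q b|.
  have ba := component_trans e_sym bD (component_refl e v Q a).
  by apply: eq_card => w; apply/idP/idP; apply: (component_trans e_sym).
have := succ_deg_sum e_sym e_irr lQ ij jm1 bR bc xb xc reg.
rewrite -DE ![e _ v]e_sym => h; apply: leq_trans h _; rewrite leq_add2l.
have [//|jm2] := ltnP j.+2 m; first by case: (e _ z).
have jE : j.+1 = m.-1 by nlia.
have := succ_nonadj e_sym lQ ij jm bR bc xb xc jm1.
by rewrite jE xm => /negPf ->.
Qed.


(** The last two vertices of [Q] have [z] as their (possibly truncated) successor, and [z] is
    adjacent to [v]. *)
Lemma attach_succ_bad w : w \in N -> ~~ e v (next_on Q w) ->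
  exists i, [/\ i.+2 < m, w = x i, x i \in N & ~~ e v (x i.+1)].
Proof.
move=> wN; have /attachP[i [b [im wE _ _]]] := wN; rewrite wE next_on_nth // => bad.
have im2 : i.+2 < m.
  rewrite ltnNge; apply: contra bad => mi; rewrite (_ : minn _ _ = m.-1) ?xm //; nlia.
by exists i; rewrite -wE; split=> //; move: bad; rewrite (_ : minn _ _ = i.+1) //; nlia.
Qed.

(** The successors that are lost when the degree of [v] is bounded from below. *)
Definition bad_next : {set T} := [set w in next_on Q @: N | ~~ e v w].

(** For two bad successors both terms at [v] in [attach_succ_deg] vanish, and its right side is at
    most [#|T| + 1]. *)
Lemma bad_next_le1 : #|T| + 2 <= k.*2 + #|D| + 1 -> #|bad_next| <= 1.
Proof.
move=> hn; apply/card_le1_eqP => p q.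
have H : forall i j, i < j -> j.+2 < m -> x i \in N -> x j \in N ->
    ~~ e v (x i.+1) -> ~~ e v (x j.+1) -> False.
  move=> i j ij jm iN jN /negPf ni /negPf nj.
  by have := attach_succ_deg ij (ltnW jm) iN jN; rewrite ni nj jm; nlia.
rewrite !inE => /andP[/imsetP[w wN ->] /(attach_succ_bad wN)[i [im -> iN nvi]]].
move=> /andP[/imsetP[w' wN' ->] /(attach_succ_bad wN')[j [jm -> jN nvj]]].
have [ij|ji|-> //] := ltngtP i j; first by case: (H i j).
by case: (H j i).
Qed.

(** The successor of [x m.-2] is [z], so the last term of [attach_succ_deg] vanishes and a single
    bad successor already contradicts the bound. *)
Lemma bad_next_last : #|T| + 2 <= k.*2 + #|D| + 1 -> x m.-2 \in N -> #|bad_next| = 0.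
Proof.
move=> hn lN; apply: eq_card0 => p; rewrite !inE.
apply/negP => /andP[/imsetP[w wN ->] /(attach_succ_bad wN)[i [im _ iN /negPf nvi]]].
have im2 : i < m.-2 by nlia.
have im3 : m.-2.+1 < m by nlia.
have := attach_succ_deg im2 im3 iN lN; rewrite nvi (_ : m.-2.+2 < m = false); last by nlia.
by case: (e v _); nlia.
Qed.

(** Some other attachment precedes [x m.-2], and with [x j.+1 = z] the right side of
    [attach_succ_deg] is at most [#|T| + 2]. *)
Lemma attach_penultimate : #|T| + 3 <= k.*2 + #|D| + 1 -> x m.-2 \notin N.
Proof.
move=> hn; apply/negP => lN; have lQ2 : m.-2 < m by nlia.
have [w wN [wu wz]] : exists2 w, w \in N & w != x m.-2 /\ w != z.
  have [w [wN wu wz]] := attach_notin_ends G lQ aR.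
  have [E|] := eqVneq w (x m.-2); last by exists w.
  have [w' w'N w'w] := attach_not_single G lQ aR wN wu wz.
  exists w' => //; split; first by rewrite -E.
  apply/negP => /eqP w'z; have mm : m.-2 < m.-1 by nlia.
  have mm1 : m.-1 < m by nlia.
  by have := attach_nth_gap mm mm1 lN; rewrite xm -w'z => /(_ w'N); nlia.
have /attachP[i [b [im wE _ _]]] := wN; rewrite wE in wN wu wz.
have im1 : i != m.-1 by apply: contraNneq wz => ->; rewrite xm.
have im2 : i != m.-2 by apply: contraNneq wu => ->.
have im3 : i < m.-2 by nlia.
have im4 : m.-2.+1 < m by nlia.
have := attach_succ_deg im3 im4 wN lN; rewrite (_ : m.-2.+2 < m = false); last by nlia.
by case: (e v _); case: (e v _); nlia.
Qed.

(** Under this bound two attachments before [z] both have successors adjacent to [v]. If [u] is an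
    attachment, a bad one can always be paired: with the interior attachment of [attach_notin_ends],
    or with [u] if it is that one. *)
Lemma bad_next_cases : #|T| + 3 <= k.*2 + #|D| + 1 ->
  #|bad_next| = 0 \/ #|bad_next| <= 1 /\ u \notin N.
Proof.
move=> hn; have [uN|uN] := boolP (u \in N); last first.
  by right; split=> //; apply: bad_next_le1; nlia.
left; apply: eq_card0 => p; rewrite !inE.
apply/negP => /andP[/imsetP[w wN ->] /(attach_succ_bad wN)[i [im _ iN /negPf nvi]]].
have H r s : r < s -> s.+1 < m -> x r \in N -> x s \in N -> e v (x r.+1) && e v (x s.+1).
  move=> rs sm rN sN; have := attach_succ_deg rs sm rN sN.
  by case: (e v _); case: (e v _); case: (_ < m); nlia.
have [w' [w'N w'u w'z]] := attach_notin_ends G lQ aR.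
have /attachP[j [b [jm wE _ _]]] := w'N; rewrite wE in w'N w'u w'z.
have j1 : j != m.-1 by apply: contraNneq w'z => ->; rewrite xm.
have j0 : j != 0 by apply: contraNneq w'u => ->; rewrite x0.
have [ij|ji|ij] := ltngtP i j.
- have jm1 : j.+1 < m by nlia.
  by have := H i j ij jm1 iN w'N; rewrite nvi.
- have im1 : i.+1 < m by nlia.
  by have := H j i ji im1 w'N iN; rewrite nvi andbF.
have [i0 im1] : 0 < i /\ i.+1 < m by split; nlia.
by have := H 0 i i0 im1 _ iN; rewrite x0 nvi andbF => /(_ uN).
Qed.

Definition neighbours_on (b : T) : {set T} := [set w in Q | e w b].

Lemma neighbours_onP b w : w \in neighbours_on b -> exists2 i, i < m & w = x i /\ e (x i) b.
Proof. by rewrite inE => /andP[/xQ[i im ->] wb]; exists i. Qed.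

Lemma neighbours_attach b : b \in D -> neighbours_on b \subset N.
Proof.
move=> bD; apply/subsetP => w /neighbours_onP[i im [-> xb]].
by apply/attachP; exists i, b.
Qed.

Lemma deg_component b : b \in D -> k <= #|neighbours_on b| + e v b + #|D|.-1.
Proof.
move=> bD; have bR := component_outside aR bD; rewrite -(reg b).
have E : #|[set w in [:: v] | e w b]| = e v b.
  have [vb|vb] := boolP (e v b).
    by rewrite -[RHS](cards1 v); apply: eq_card => w; rewrite !inE; case: eqP => //= ->.
  by apply: eq_card0 => w; rewrite !inE; case: eqP => //= ->; rewrite (negPf vb).
have -> : #|D|.-1 = #|D :\ b| by rewrite (cardsD1 b D) bD.
rewrite -E; apply: leq_trans (leq_add (leq_card_setU _ _) (leqnn _)).
apply: leq_trans (leq_card_setU _ _); apply/subset_leq_card/subsetP => w.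
rewrite [w \in nbhd _ _]inE => bw; have wb : e w b by rewrite e_sym.
have [wv|wv] := eqVneq w v.
  by apply/setUP; left; apply/setUP; right; rewrite inE wb wv mem_head.
have [wQ|wQ] := boolP (w \in Q).
  by apply/setUP; left; apply/setUP; left; rewrite inE wQ wb.
have wD : w \in D by apply: component_edge bD bw bR _; rewrite !inE negb_or wv.
by rewrite in_setU in_setD1 wD andbT; apply/orP; right; apply: contraTneq bw => ->; rewrite e_irr.
Qed.

(** Neighbours of [b] are never consecutive on [Q], so the truncation at the end cannot identify the
    successors of [x m.-2] and [z]. *)
Lemma next_on_inj b : b \in D -> {in neighbours_on b &, injective (next_on Q)}.
Proof.
move=> bD p q /neighbours_onP[i im [-> xi]] /neighbours_onP[j jm [-> xj]].
rewrite !next_on_nth // => /x_inj E.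
have {}E : minn i.+1 m.-1 = minn j.+1 m.-1 by apply: E; nlia.
have [ij|ji|-> //] := ltngtP i j.
  by have [] := attach_index_gap ij jm bD bD xi xj; nlia.
by have [] := attach_index_gap ji im bD bD xj xi; nlia.
Qed.

Lemma card_next_neighbours b : b \in D -> #|next_on Q @: neighbours_on b| = #|neighbours_on b|.
Proof. by move=> bD; apply/card_in_imset/next_on_inj. Qed.

End Component.

(** * The vertices outside the path are pairwise non-adjacent *)

Section Independence.
Variables (T : finType) (e : rel T) (k : nat).
Variables (u v z : T) (Q : seq T).
Hypotheses (G : setting e k u v z) (lQ : longest e u v z Q).
Let e_sym : symmetric e. Proof. by case: G => [[[]]]. Qed.
Let e_irr : irreflexive e. Proof. by case: G => [[[]]]. Qed.
Let reg : k_regular e k. Proof. by case: G => [[]]. Qed.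
Let nk : #|T| <= k.*2.+1. Proof. by case: G => [[]]. Qed.
Let uz : u != z. Proof. by case: G => [_ [[]]]. Qed.
Let euv : e u v. Proof. by case: G => [_ []]. Qed.
Let evz : e v z. Proof. by case: G => [_ []]. Qed.
Local Notation x := (nth v Q).
Local Notation m := (size Q).
Let uniqQ : uniq Q. Proof. by case: (longest_ends lQ). Qed.
Let x0 : x 0 = u. Proof. by case: (longest_ends lQ). Qed.
Let xm : x m.-1 = z. Proof. by case: (longest_ends lQ). Qed.
Let m0 : 0 < m. Proof. by case: (longest_ends lQ). Qed.
Let m1 : 1 < m.
Proof.
by rewrite ltn_neqAle m0 andbT eq_sym; apply: contraNneq uz => s1; rewrite -x0 -xm s1.
Qed.
Let x_inj i j : i < m -> j < m -> x i = x j -> i = j.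
Proof. by move=> im jm /eqP; rewrite nth_uniq // => /eqP. Qed.
Let Gr := setting_sym G.
Let lQr := longest_rev e_sym lQ.

Lemma attach_rev a : attach e v (rev Q) a = attach e v Q a.
Proof. by apply/setP => w; rewrite !inE mem_rev component_rev. Qed.

Section Edge.
Variables (a b : T).
Hypotheses (aR : a \in outside v Q) (bR : b \in outside v Q) (ab : e a b).
Local Notation D := (component e v Q a).
Local Notation N := (attach e v Q a).
Let aD : a \in D. Proof. exact: component_refl. Qed.
Let bD : b \in D. Proof. exact: component_edge aD ab aR bR. Qed.
Let nab : a != b. Proof. by apply: contraTneq ab => ->; rewrite e_irr. Qed.
Let aRr : a \in outside v (rev Q). Proof. by rewrite outside_rev. Qed.

Definition bad_prev : {set T} := [set w in prev_on Q @: N | ~~ e v w].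

Lemma bad_prev_rev : bad_next e v (rev Q) a = bad_prev.
Proof.
rewrite /bad_next attach_rev /bad_prev (_ : next_on (rev Q) @: N = prev_on Q @: N) //.
by apply: eq_in_imset => p; rewrite inE => /andP[pQ _]; rewrite prev_on_rev.
Qed.

Lemma card_prev_neighbours c : c \in D -> #|prev_on Q @: neighbours_on e Q c| = #|neighbours_on e Q c|.
Proof.
move=> cD; have E : neighbours_on e (rev Q) c = neighbours_on e Q c.
  by apply/setP => w; rewrite !inE mem_rev.
have cDr : c \in component e v (rev Q) a by rewrite component_rev.
rewrite -[in RHS]E -(card_next_neighbours Gr lQr aRr cDr) E.
rewrite (_ : prev_on Q @: _ = next_on (rev Q) @: neighbours_on e Q c) //.
by apply: eq_in_imset => p; rewrite inE => /andP[pQ _]; rewrite prev_on_rev.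
Qed.

Let W := next_on Q @: neighbours_on e Q a :|: prev_on Q @: neighbours_on e Q b.

Lemma card_next_prev : #|W| = #|neighbours_on e Q a| + #|neighbours_on e Q b|.
Proof.
rewrite /W cardsU (card_next_neighbours G lQ aR aD) (card_prev_neighbours bD).
rewrite [X in _ - X](_ : _ = 0) ?subn0 //; apply: eq_card0 => w; rewrite inE.
apply/negP => /andP[/imsetP[p /(neighbours_onP v)[i im [-> xa]] ->]].
move=> /imsetP[q /(neighbours_onP v)[j jm [-> xb]]].
rewrite next_on_nth // prev_on_nth // => /x_inj E.
have {}E : minn i.+1 m.-1 = j.-1 by apply: E; nlia.
have ij : i < j by nlia.
by have [_ /(_ nab)] := attach_index_gap G lQ aR ij jm aD bD xa xb; nlia.
Qed.

(* Attachments of [a] and of [b] are at distance at least 3 when distinct, so the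
   two images in [W] are disjoint; up to the bad vertices they lie in [N(v)],
   together with [u], [z] and those of [a], [b] that are adjacent to [v]. *)
Lemma degree_count : k + (u \notin W) + (z \notin W) <=
  (#|D|.-1).*2 + #|bad_next e v Q a| + #|bad_prev|.
Proof.
have ka := deg_component G aR aD; have kb := deg_component G aR bD.
have WN : #|W :\: nbhd e v| <= #|bad_next e v Q a| + #|bad_prev|.
  apply: leq_trans (leq_card_setU _ _); apply/subset_leq_card/subsetP => w.
  rewrite in_setD !in_setU [w \in nbhd _ _]inE => /andP[vw /orP[] /imsetP[p pN wE]]; apply/orP.
    left; rewrite inE vw andbT wE; apply: imset_f.
    exact: (subsetP (neighbours_attach aD)).
  right; rewrite inE vw andbT wE; apply: imset_f.
  exact: (subsetP (neighbours_attach bD)).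
have := cardsID (nbhd e v) W; rewrite card_next_prev => cW.
have := cardsID W (nbhd e v); rewrite reg setIC => cv.
have sub : [set w in [:: u; z] | w \notin W] :|: [set w in [:: a; b] | e v w] \subset nbhd e v :\: W.
  have nQ p : p \in outside v Q -> p \notin W.
    rewrite inE inE negb_or => /andP[_]; apply: contra; rewrite in_setU.
    by case/orP => /imsetP[q /(neighbours_onP v)[i im [-> _]] ->];
      rewrite ?next_on_nth ?prev_on_nth //; apply/mem_nth;
      [have : minn i.+1 m.-1 < m by nlia | have : i.-1 < m by nlia].
  apply/subsetP => w; rewrite in_setU in_setD [w \in nbhd _ _]inE.
  case/orP; rewrite inE => /andP[].
    by move=> wuz ->; move: wuz; rewrite !inE => /orP[] /eqP-> //; rewrite e_sym.
  by move=> wab ->; rewrite andbT; apply: nQ; move: wab; rewrite inE => /predU1P[->|] //; rewrite inE => /eqP->.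
have := subset_leq_card sub; rewrite cardsU !card_pair_filter //.
rewrite [X in _ - X](_ : _ = 0) ?subn0.
  by move: ka kb WN cW cv; do ?[move: #|_|]; nlia.
apply: eq_card0 => w; rewrite !inE; apply/negP => /andP[/andP[wuz _] /andP[wab _]].
have wQ : w \in Q.
  by move: wuz => /orP[] /eqP->; [rewrite -x0 | rewrite -xm]; apply: mem_nth; rewrite ?prednK.
by move: aR bR; rewrite !inE !negb_or => /andP[_ aQ] /andP[_ bQ];
  move: wab => /orP[] /eqP wE; [rewrite -wE wQ in aQ | rewrite -wE wQ in bQ].
Qed.

(** A predecessor is never [z], and only [x m.-2] and, by truncation, [z] itself have successor
    [z]. *)
Lemma next_prev_z : x m.-2 \notin N -> z \in W -> z \in neighbours_on e Q a.
Proof.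
move=> lN; rewrite in_setU => /orP[] /imsetP[p pN];
  have /(neighbours_onP v)[i im [pE xp]] := pN.
  rewrite pE next_on_nth // -{1}xm => /x_inj E; have {}E : m.-1 = minn i.+1 m.-1 by apply: E; nlia.
  have [i1|i2] : i = m.-1 \/ i = m.-2 by nlia.
    by rewrite -xm -i1 -pE.
  case/negP: lN; rewrite -i2 -pE; exact: (subsetP (neighbours_attach aD)).
rewrite pE prev_on_nth // -{1}xm => /x_inj E; have {}E : m.-1 = i.-1 by apply: E; nlia.
by nlia.
Qed.

Lemma next_prev_u : x 1 \notin N -> u \in W -> u \in neighbours_on e Q b.
Proof.
move=> lN; rewrite in_setU => /orP[] /imsetP[p pN];
  have /(neighbours_onP v)[i im [pE xp]] := pN.
  rewrite pE next_on_nth // -{1}x0 => /x_inj E; have {}E : 0 = minn i.+1 m.-1 by apply: E; nlia.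
  by nlia.
rewrite pE prev_on_nth // -{1}x0 => /x_inj E; have {}E : 0 = i.-1 by apply: E; nlia.
have [i1|i2] : i = 0 \/ i = 1 by nlia.
  by rewrite -x0 -i1 -pE.
case/negP: lN; rewrite -i2 -pE; exact: (subsetP (neighbours_attach bD)).
Qed.

Let card_T : #|T| = m.+1 + #|outside v Q|.
Proof. by apply: card_outside; case: lQ => /andP[]. Qed.

Lemma component_size_le : m + 1 + #|D| <= #|T|.
Proof.
rewrite card_T addn1 leq_add2l; apply/subset_leq_card/subsetP => w; exact: component_outside.
Qed.

Lemma component_size_gt1 : 1 < #|D|.
Proof. by rewrite (cardsD1 a) aD (cardsD1 b) !inE eq_sym nab /= -[connect _ _ _]in_set bD. Qed.

Lemma middle_attach : exists i c, [/\ 0 < i, i.+1 < m, x i \in N, c \in D & e (x i) c].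
Proof.
have [w [wN wu wz]] := attach_notin_ends G lQ aR.
have /attachP[i [c [im wE cD xc]]] := wN; rewrite wE in wN wu wz.
exists i, c; split=> //; first by rewrite lt0n; apply: contraNneq wu => ->; rewrite x0.
have : i != m.-1 by apply: contraNneq wz => ->; rewrite xm.
by nlia.
Qed.

Lemma other_attach w : w \in N -> w != u -> w != z ->
  exists j c, [/\ j < m, w != x j, x j \in N, c \in D & e (x j) c].
Proof.
move=> wN wu wz; have [w' wN' ww'] := attach_not_single G lQ aR wN wu wz.
have /attachP[j [c [jm wE cD xc]]] := wN'; exists j, c; split=> //; last by rewrite -wE.
by rewrite -wE eq_sym.
Qed.

Lemma m_ge3 : 2 < m.
Proof. by have [i [c [i0 im _ _ _]]] := middle_attach; nlia. Qed.

End Edge.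

Lemma component_eq a b : b \in component e v Q a -> component e v Q b = component e v Q a.
Proof.
move=> bD; have ba := component_trans e_sym bD (component_refl e v Q a).
by apply/setP => w; apply/idP/idP; apply: (component_trans e_sym).
Qed.

Let nth_rev_Q i : i < m -> nth v (rev Q) i = x (m - i.+1).
Proof. by move=> im; rewrite nth_rev. Qed.

Let revE a : a \in outside v Q -> [/\ a \in outside v (rev Q),
  component e v (rev Q) a = component e v Q a, attach e v (rev Q) a = attach e v Q a &
  nth v (rev Q) (size (rev Q)).-2 = x 1].
Proof.
move=> aR; rewrite outside_rev component_rev attach_rev; split=> //.
by rewrite size_rev nth_rev_Q; [congr nth|]; nlia.
Qed.

Lemma bad_prev_le1 a : a \in outside v Q ->
  #|T| + 2 <= k.*2 + #|component e v Q a| + 1 -> #|bad_prev a| <= 1.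
Proof.
move=> aR hn; have [aRr cE nE _] := revE aR.
by rewrite -bad_prev_rev; apply: (bad_next_le1 Gr lQr aRr); rewrite cE.
Qed.

Lemma bad_prev_first a : a \in outside v Q ->
  #|T| + 2 <= k.*2 + #|component e v Q a| + 1 -> x 1 \in attach e v Q a -> #|bad_prev a| = 0.
Proof.
move=> aR hn fN; have [aRr cE nE x1] := revE aR.
by rewrite -bad_prev_rev; apply: (bad_next_last Gr lQr aRr); rewrite ?cE // x1 nE.
Qed.

Lemma attach_second a : a \in outside v Q ->
  #|T| + 3 <= k.*2 + #|component e v Q a| + 1 -> x 1 \notin attach e v Q a.
Proof.
move=> aR hn; have [aRr cE nE x1] := revE aR.
by rewrite -nE -x1; apply: (attach_penultimate Gr lQr aRr); rewrite cE.
Qed.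

Lemma bad_prev_cases a : a \in outside v Q -> #|T| + 3 <= k.*2 + #|component e v Q a| + 1 ->
  #|bad_prev a| = 0 \/ #|bad_prev a| <= 1 /\ z \notin attach e v Q a.
Proof.
move=> aR hn; have [aRr cE nE x1] := revE aR.
by rewrite -bad_prev_rev -nE; apply: (bad_next_cases Gr lQr aRr); rewrite cE.
Qed.

(** Take an attachment [x i] inside [Q] and another one [x j]. Reversing [Q] if necessary makes
    [x i] the later one, so both have successors, and the three extra terms of [attach_succ_deg] are
    at most 1 each. *)
Lemma component_bound a : a \in outside v Q -> k.*2 + #|component e v Q a| <= #|T| + 2.
Proof.
move=> aR; have [i [c [i0 im iN cD xc]]] := middle_attach aR.
have iz : x i != z.
  apply/negP => /eqP; rewrite -xm => /x_inj h; have : i = m.-1 by apply: h; nlia.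
  by nlia.
have iu : x i != u.
  apply/negP => /eqP; rewrite -x0 => /x_inj h; have : i = 0 by apply: h; nlia.
  by nlia.
have [j [c' [jm ij jN cD' xc']]] := other_attach aR iN iu iz.
have [ij'|ji|E] := ltngtP i j; last by rewrite E eqxx in ij.
  have [aRr cE nE x1] := revE aR.
  have h1 : m - j.+1 < m - i.+1 by nlia.
  have h2 : (m - i.+1).+1 < size (rev Q) by rewrite size_rev; nlia.
  have := attach_succ_deg Gr lQr aRr h1 h2; rewrite nE !nth_rev_Q; try nlia.
  have -> : m - (m - j.+1).+1 = j by nlia.
  have -> : m - (m - i.+1).+1 = i by nlia.
  move=> /(_ jN iN); rewrite cE.
  by nlia.
have := attach_succ_deg G lQ aR ji im jN iN.
by nlia.
Qed.

Lemma outside_independent a b : a \in outside v Q -> b \in outside v Q -> ~~ e a b.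
Proof.
move=> aR bR; apply/negP => ab.
have ba : e b a by rewrite e_sym.
have bD : b \in component e v Q a by apply: component_edge ab aR bR; apply: component_refl.
have cE := component_eq bD.
have m3 := m_ge3 aR; have Dm := component_size_le aR; have d2 := component_size_gt1 aR bR ab.
have k3 : 2 < k by nlia.
(* The degree sum would be 21. *)
have k3n7 : k = 3 -> #|T| = 7 -> False.
  by move=> k3' n7; have := even_degree_sum e_sym e_irr reg; rewrite k3' n7.
have [i [c [i0 im iN cD xc]]] := middle_attach aR.
(* The first case below is [#|D| = 2], [n = 2k + 1]; in the second one,
   [(#|D|, n)] is [(3, 2k + 1)] or [(2, 2k)]. *)
have [hn|hn] := leqP (#|T| + 3) (k.*2 + #|component e v Q a| + 1); last first.
  (* Here [degree_count] bounds [k] by [2 + 1 + 1], and parity excludes [k = 3]. Equality makes both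
     bad sets non-empty and puts [u] and [z] among the shifted neighbours; non-empty bad sets keep
     [x 1] and [x m.-2] from being attachments, so only truncation at the ends remains. *)
  have key p q : p \in outside v Q -> q \in outside v Q -> e p q ->
      component e v Q p = component e v Q a ->
      [/\ k = 4, z \in neighbours_on e Q p & u \in neighbours_on e Q q].
    move=> pR qR pq pE; have hn2 : #|T| + 2 <= k.*2 + #|component e v Q p| + 1.
      by rewrite pE; nlia.
    have b1 := bad_next_le1 G lQ pR hn2; have b2 := bad_prev_le1 pR hn2.
    have b3 := bad_next_last G lQ pR hn2; have b4 := bad_prev_first pR hn2.
    have dc := degree_count pR qR pq.
    have k4 : k = 4.
      have : k <= 4.
        by move: dc; rewrite pE; nlia.
      move=> k4; have [k3'|//] : k = 3 \/ k = 4 by nlia.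
      by exfalso; apply: (k3n7 k3'); nlia.
    have uW h1 h2 := next_prev_u pR qR pq h2 h1; have zW h1 h2 := next_prev_z (a := p) (b := q) h2 h1.
    move: dc b1 b2; case: (boolP (u \in _)) => [/uW uB|_]; last first.
      by rewrite pE; case: (z \notin _); nlia.
    case: (boolP (z \in _)) => [/zW zA|_]; last by rewrite pE; nlia.
    rewrite pE => dc b1 b2; split=> //; [apply: zA | apply: uB].
      by apply/negP => /b3; nlia.
    by apply/negP => /b4; nlia.
  have [k4 za ub] := key a b aR bR ab erefl; have [_ zb ua] := key b a bR aR ba cE.
  (* Both [a] and [b] are adjacent to [u] and [z], and one of them is not [c]; so [x i] is at
     distance at least 3 from both ends, too far for at most 6 vertices on [Q]. *)
  have [r [rD rc zr ur]] : exists r, [/\ r \in component e v Q a, r != c, e z r & e u r].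
    move: za ub zb ua; rewrite !inE => /andP[_ za] /andP[_ ub] /andP[_ zb] /andP[_ ua].
    have [ac|ac] := eqVneq a c; last by exists a; split=> //; apply: component_refl.
    by exists b; split=> //; rewrite -ac; apply: contraTneq ab => ->; rewrite e_irr.
  have im' : i < m by nlia.
  have im1 : i < m.-1 by nlia.
  have m1m : m.-1 < m by nlia.
  have xr0 : e (x 0) r by rewrite x0.
  have xrm : e (x m.-1) r by rewrite xm.
  have [_ /(_ rc) g1] := attach_index_gap G lQ aR i0 im' rD cD xr0 xc.
  rewrite eq_sym in rc; have [_ /(_ rc) g2] := attach_index_gap G lQ aR im1 m1m cD rD xc xrm.
  by nlia.
have cb := component_bound aR.
have x1N := attach_second aR hn; have xmN := attach_penultimate G lQ aR hn.
have dc := degree_count aR bR ab.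
have uW := next_prev_u aR bR ab x1N; have zW := next_prev_z (b := b) xmN.
(* Bad vertices are compensated: a bad successor means that [u] is no attachment and so contributes
   1 on the left of [degree_count]; likewise a bad predecessor and [z]. This excludes [#|D| = 2]. *)
have kd : k <= (#|component e v Q a|.-1).*2.
  have bn := bad_next_cases G lQ aR hn; have bp := bad_prev_cases aR hn.
  have subN p : p \in component e v Q a -> {subset neighbours_on e Q p <= attach e v Q a}.
    by move=> pD; apply/subsetP; apply: neighbours_attach.
  move: dc; case: (boolP (u \in _)) => [/uW/(subN _ bD) uN|_];
    case: (boolP (z \in _)) => [/zW/(subN _ (component_refl e v Q a)) zN|_];
    case: bn => [->|[b1 uN']]; case: bp => [->|[b2 zN']];
    first [by rewrite uN in uN' | by rewrite zN in zN' | nlia].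
have k4 : k = 4.
  have [k3'|//] : k = 3 \/ k = 4 by nlia.
  by exfalso; apply: (k3n7 k3'); nlia.
(* Now [#|D| = 3] and [#|T| = 9], so [m <= 5], and the interior [x i] is neither second nor last but
   one. *)
have [m5 i2] : m = 5 /\ i = 2.
  have i1 : i != 1 by apply: contraNneq x1N => <-.
  have im2 : i != m.-2 by apply: contraNneq xmN => <-.
  by nlia.
(* Only [x 0], [x 2], [x 4] can be attachments. At distance 2, [attach_index_gap] leaves a single
   common neighbour in the component, so all of them attach to [c]. *)
have only j p : j < m -> p \in component e v Q a -> e (x j) p -> p = c.
  have im' : i < m by nlia.
  have H2 r s : r < m -> s \in component e v Q a -> e (x r) s -> r != 2 -> s = c.
    move=> rm sD xs r2; have rN : x r \in attach e v Q a by apply/attachP; exists r, s.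
    have r1 : r != 1 by apply: contraNneq x1N => <-.
    have r3 : r != m.-2 by apply: contraNneq xmN => <-.
    apply/eqP; apply: contraT => sc; have [ri|ir] : r < i \/ i < r by nlia.
      by have [_ /(_ sc)] := attach_index_gap G lQ aR ri im' sD cD xs xc; nlia.
    rewrite eq_sym in sc.
    by have [_ /(_ sc)] := attach_index_gap G lQ aR ir rm cD sD xc xs; nlia.
  move=> jm pD xp; have [j2|] := eqVneq j 2; last exact: H2 xp.
  have iz : x i != z.
    apply/negP => /eqP; rewrite -xm => /x_inj h; have : i = m.-1 by apply: h; nlia.
    by nlia.
  have iu : x i != u.
    apply/negP => /eqP; rewrite -x0 => /x_inj h; have : i = 0 by apply: h; nlia.
    by nlia.
  have [r [s [rm ir rN sD xs]]] := other_attach aR iN iu iz.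
  have r2 : r != 2 by apply: contraNneq ir => ->; rewrite i2.
  have sc := H2 r s rm sD xs r2; rewrite j2 in xp jm.
  have r1 : r != 1 by apply: contraNneq x1N => <-.
  have r3 : r != m.-2 by apply: contraNneq xmN => <-.
  rewrite -sc; apply/eqP; apply: contraT => ps; have [ri|ir'] : r < 2 \/ 2 < r by nlia.
    rewrite eq_sym in ps.
    by have [_ /(_ ps)] := attach_index_gap G lQ aR ri jm sD pD xs xp; nlia.
  by have [_ /(_ ps)] := attach_index_gap G lQ aR ir' rm pD sD xp xs; nlia.
(* A vertex of the component other than [c] has no neighbour on [Q], so its degree is at most 3. *)
have [p [pD pc]] : exists p, p \in component e v Q a /\ p != c.
  have := d2; rewrite (cardsD1 c) cD ltnS => /card_gt0P[p]; rewrite in_setD1 => /andP[pc pD].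
  by exists p.
have p0 : #|neighbours_on e Q p| = 0.
  apply: eq_card0 => w; apply/negP => /(neighbours_onP v)[j jm [_ xp]].
  by rewrite (only j p jm pD xp) eqxx in pc.
have := deg_component G aR pD; rewrite p0.
by have := leq_b1 (e v p); nlia.
Qed.

End Independence.

(** * A vertex outside the path and the successors of its neighbours *)

Section Isolated.
Variables (T : finType) (e : rel T) (k : nat).
Variables (u v z : T) (Q : seq T).
Hypotheses (G : setting e k u v z) (lQ : longest e u v z Q).
Let e_sym : symmetric e. Proof. by case: G => [[[]]]. Qed.
Let e_irr : irreflexive e. Proof. by case: G => [[[]]]. Qed.
Let reg : k_regular e k. Proof. by case: G => [[]]. Qed.
Let nk : #|T| <= k.*2.+1. Proof. by case: G => [[]]. Qed.
Local Notation x := (nth v Q).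
Local Notation m := (size Q).
Let uniqQ : uniq Q. Proof. by case: (longest_ends lQ). Qed.
Let vQ : v \notin Q. Proof. by case: (longest_ends lQ). Qed.
Let x0 : x 0 = u. Proof. by case: (longest_ends lQ). Qed.
Let xm : x m.-1 = z. Proof. by case: (longest_ends lQ). Qed.
Let m0 : 0 < m. Proof. by case: (longest_ends lQ). Qed.
Let x_inj i j : i < m -> j < m -> x i = x j -> i = j.
Proof. by move=> im jm /eqP; rewrite nth_uniq // => /eqP. Qed.

Variable y : T.
Hypothesis yR : y \in outside v Q.
Let yD : y \in component e v Q y. Proof. exact: component_refl. Qed.
Local Notation N := (neighbours_on e Q y).
Let xN i : i < m -> (x i \in N) = e (x i) y.
Proof. by move=> im; rewrite inE mem_nth. Qed.

Let gap i j : i < j -> j < m -> e (x i) y -> e (x j) y -> i.+1 < j.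
Proof. by move=> ij jm xi xj; case: (attach_index_gap G lQ yR ij jm yD yD xi xj). Qed.


(** Without [z], the truncation in [next_on] never takes effect. *)
Definition succs : {set T} := next_on Q @: (N :\ z).

Lemma succsP w : reflect (exists i, [/\ i.+1 < m, e (x i) y & w = x i.+1]) (w \in succs).
Proof.
apply: (iffP imsetP) => [[p]|[i [im xi ->]]].
  rewrite in_setD1 => /andP[pz /(neighbours_onP v)[i im [pE xi]]] ->.
  have i1 : i != m.-1 by apply: contraNneq pz => i1; rewrite pE i1 xm.
  exists i; split=> //; first nlia.
  by rewrite pE next_on_nth //; congr nth; nlia.
have im' : i < m by nlia.
exists (x i); first rewrite in_setD1 xN // xi andbT.
  by apply: contraTneq im; rewrite -xm => /x_inj h; rewrite -leqNgt h //; nlia.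
by rewrite next_on_nth //; congr nth; nlia.
Qed.

Lemma card_succs : #|succs| + (z \in N) = #|N|.
Proof.
rewrite (cardsD1 z N) addnC; congr (_ + _); apply: card_in_imset.
by apply: sub_in2 (next_on_inj G lQ yR yD) => p; rewrite in_setD1 => /andP[].
Qed.

Lemma succs_nadj p : p \in succs -> ~~ e p y.
Proof.
case/succsP => i [im xi ->]; apply/negP => xi1.
by have := gap (ltnSn i) im xi xi1; rewrite ltnn.
Qed.

Lemma succs_nadj2 p q : p \in succs -> q \in succs -> ~~ e p q.
Proof.
case/succsP => i [im xi ->] /succsP[j [jm xj ->]].
have [ij|ji|->] := ltngtP i j; last by rewrite e_irr.
  exact: (succ_nonadj e_sym lQ ij (ltnW jm) yR yD xi xj jm).
rewrite e_sym; exact: (succ_nonadj e_sym lQ ji (ltnW im) yR yD xj xi im).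
Qed.

Lemma succs_Q p : p \in succs -> p \in Q.
Proof. by case/succsP => i [im _ ->]; apply: mem_nth. Qed.

Lemma succs_neq_u : u \notin succs.
Proof.
apply/negP => /succsP[i [im _]]; rewrite -x0 => /x_inj h.
by have : 0 = i.+1 by apply: h.
Qed.

Lemma succs_independent : independent e (y |: succs).
Proof.
move=> p q /setU1P[->|pS] /setU1P[->|qS]; rewrite ?e_irr //.
- by rewrite e_sym succs_nadj.
- exact: succs_nadj.
exact: succs_nadj2.
Qed.

Let yNQ : y \notin Q. Proof. by move: yR; rewrite !inE negb_or => /andP[]. Qed.

(** By [outside_independent], all neighbours of [y] lie on [Q], except possibly [v]. *)
Lemma card_neighbours : #|N| + e v y = k.
Proof.
rewrite -(reg y) -(cardsID [set v] (nbhd e y)) addnC; congr (_ + _).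
  have [vy|vy] := boolP (e v y).
    rewrite -[LHS](cards1 v); apply: eq_card => w; rewrite !inE.
    by case: eqP => [->|]; rewrite ?andbF // e_sym vy.
  apply/esym/eq_card0 => w; rewrite !inE.
  by case: eqP => [->|]; rewrite ?andbF // e_sym (negPf vy).
apply: eq_card => w; rewrite !inE [e y w]e_sym.
have [->|wv] /= := eqVneq w v; first by rewrite (negPf vQ).
have [//|wQ] := boolP (w \in Q).
have wR : w \in outside v Q by rewrite !inE negb_or wv.
by rewrite (negPf (outside_independent G lQ wR yR)).
Qed.

(** Otherwise all [k] neighbours of [y] have successors, and these with [y] form an independent set
    of [k + 1] vertices. *)
Lemma nonadjacent_z : ~~ e v y -> z \in N.
Proof.
move=> vy; have k0 : 0 < k := ltnW (setting_k2 G).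
have := independent_card e_sym reg k0 nk succs_independent.
rewrite cardsU1 (contra (@succs_Q y)) // => h.
have := card_neighbours; rewrite (negPf vy) -card_succs.
by case: (z \in N) => // h2; nlia.
Qed.

End Isolated.

Lemma neighbours_on_rev (T : finType) (e : rel T) (Q : seq T) y :
  neighbours_on e (rev Q) y = neighbours_on e Q y.
Proof. by apply/setP => w; rewrite !inE mem_rev. Qed.

(** If not, [y] is adjacent to both ends of [Q]. The [k - 1] successors then avoid [u] and also [z],
    a neighbour of [y]; with [y] they are [k] independent vertices, against
    [independent_avoiding_card]. *)
Lemma outside_adjacent (T : finType) (e : rel T) k u v z Q y : setting e k u v z ->
  longest e u v z Q -> y \in outside v Q -> e v y.
Proof.
move=> G lQ yR; have e_sym : symmetric e by case: G => [[[]]].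
apply: contraT => vy; have zN := nonadjacent_z G lQ yR vy.
have uN : u \in neighbours_on e Q y.
  rewrite -neighbours_on_rev.
  by apply: (nonadjacent_z (setting_sym G) (longest_rev e_sym lQ)) => //; rewrite outside_rev.
have sQ := @succs_Q _ e k u v z Q G lQ y.
have [yv yQ] : y != v /\ y \notin Q by apply/andP; move: yR; rewrite !inE negb_or.
have [_ _ _ _ vQ] := longest_ends lQ.
have uQ : u \in Q by move: uN; rewrite inE => /andP[].
have zQ : z \in Q by move: zN; rewrite inE => /andP[].
have := independent_avoiding_card G (succs_independent G lQ yR).
rewrite !in_setU1 !negb_or (succs_neq_u G lQ y) (contra (@sQ v)) // cardsU1 (contra (@sQ y)) //.
have -> : u != y by apply: contraNneq yQ => <-.
have -> : z != y by apply: contraNneq yQ => <-.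
rewrite eq_sym yv /= => /(_ isT isT); rewrite (contraL (@succs_nadj _ _ _ _ _ _ _ G lQ _ yR z)).
  have := card_succs G lQ yR; have := card_neighbours G lQ yR.
  by rewrite zN (negPf vy) => h1 h2 /(_ isT) h3; nlia.
by move: zN; rewrite inE => /andP[].
Qed.

(** * No vertex is left outside a longest path *)

Section Spanning.
Variables (T : finType) (e : rel T) (k : nat).
Variables (u v z : T) (Q : seq T).
Hypotheses (G : setting e k u v z) (lQ : longest e u v z Q).
Let e_sym : symmetric e. Proof. by case: G => [[[]]]. Qed.
Let e_irr : irreflexive e. Proof. by case: G => [[[]]]. Qed.
Let reg : k_regular e k. Proof. by case: G => [[]]. Qed.
Let nk : #|T| <= k.*2.+1. Proof. by case: G => [[]]. Qed.
Let uz : u != z. Proof. by case: G => [_ [[]]]. Qed.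
Let euv : e u v. Proof. by case: G => [_ []]. Qed.
Let evz : e v z. Proof. by case: G => [_ []]. Qed.
Local Notation x := (nth v Q).
Local Notation m := (size Q).
Let uniqQ : uniq Q. Proof. by case: (longest_ends lQ). Qed.
Let vQ : v \notin Q. Proof. by case: (longest_ends lQ). Qed.
Let x0 : x 0 = u. Proof. by case: (longest_ends lQ). Qed.
Let xm : x m.-1 = z. Proof. by case: (longest_ends lQ). Qed.
Let m0 : 0 < m. Proof. by case: (longest_ends lQ). Qed.
Let x_inj i j : i < m -> j < m -> x i = x j -> i = j.
Proof. by move=> im jm /eqP; rewrite nth_uniq // => /eqP. Qed.
Let xQ w : w \in Q -> exists2 i, i < m & w = x i.
Proof. by move=> wQ; exists (index w Q); rewrite ?index_mem ?nth_index. Qed.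
Let Gr := setting_sym G.
Let lQr := longest_rev e_sym lQ.

Variable y : T.
Hypothesis yR : y \in outside v Q.
Let yRr : y \in outside v (rev Q). Proof. by rewrite outside_rev. Qed.
Let yD : y \in component e v Q y. Proof. exact: component_refl. Qed.
Local Notation N := (neighbours_on e Q y).
Let xN i : i < m -> (x i \in N) = e (x i) y.
Proof. by move=> im; rewrite inE mem_nth. Qed.
Let gap i j : i < j -> j < m -> e (x i) y -> e (x j) y -> i.+1 < j.
Proof. by move=> ij jm xi xj; case: (attach_index_gap G lQ yR ij jm yD yD xi xj). Qed.
Let wseg i j : i <= j -> j < m -> walk e (x i) (x j) (seg Q i j).
Proof. by apply: walk_seg; case: lQ => /andP[_ /and4P[]]. Qed.
Let cQ P i : i < m.-1 ->
  count P Q = count P (seg Q 0 i) + count P (seg Q i.+1 m.-1).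
Proof. by move=> im; rewrite -(count_seg P Q) // seg_full. Qed.
Let yQ : {in [:: y], forall w, w \notin v :: Q}.
Proof. by move=> w; rewrite inE => /eqP ->; move: yR; rewrite inE. Qed.
Let yNQ : y \notin Q. Proof. by move: yR; rewrite !inE negb_or => /andP[]. Qed.
Let ynv : y != v. Proof. by move: yR; rewrite !inE negb_or => /andP[]. Qed.
Let no_longer (Q' : seq T) : walk e u z Q' ->
  (forall P, count P Q' = count P Q + P y) -> False.
Proof.
move=> wQ' cQ'; have := longest_walk lQ (D := [:: y]) isT yQ wQ' _.
rewrite -(count_predT Q') cQ' count_predT addn1 ltnn => h.
by have: false by apply: h => P; rewrite cQ' /= addn0.
Qed.

Local Notation S := (succs e z Q y).
Local Notation R := (succs e u (rev Q) y).

(** [R] is a set of successors on [rev Q]; read on [Q], these are predecessors of neighbours of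
    [y]. *)
Lemma predsP w : reflect (exists i, [/\ i.+1 < m, e (x i.+1) y & w = x i]) (w \in R).
Proof.
have H i : i.+1 < m -> nth v (rev Q) i = x (m - i.+1) /\ nth v (rev Q) i.+1 = x (m - i.+2).
  by move=> im; rewrite !nth_rev //; nlia.
apply: (iffP (succsP Gr lQr y w)); rewrite size_rev => -[i [im xi ->]].
  have [E1 E2] := H i im; exists (m - i.+2); rewrite E2; split=> //; first by nlia.
  by rewrite E1 in xi; rewrite (_ : (m - i.+2).+1 = m - i.+1) //; nlia.
have im' : (m - i.+2).+1 < m by nlia.
have [E1 E2] := H _ im'; exists (m - i.+2); split=> //.
  by rewrite E1 (_ : m - (m - i.+2).+1 = i.+1) //; nlia.
by rewrite E2 (_ : m - (m - i.+2).+2 = i) //; nlia.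
Qed.

Lemma succs_predsP w : w \in S -> w \in R ->
  exists i, [/\ i.+2 < m, e (x i) y, e (x i.+2) y & w = x i.+1].
Proof.
case/(succsP G lQ) => i [im xi ->] /predsP[j [jm xj]] /x_inj h.
have E : i.+1 = j by apply: h; nlia.
by exists i; rewrite E; split.
Qed.

(** Putting [y] in the place of [w] gives another longest path; [w] is outside it, so
    [outside_adjacent] applies to [w]. *)
Lemma exchange_adjacent w : w \in S -> w \in R -> e v w.
Proof.
move=> wS wR; have [i [im xi xi2 wE]] := succs_predsP wS wR.
set Q' := seg Q 0 i ++ [:: y] ++ seg Q i.+2 m.-1.
have wk : walk e u z Q'.
  rewrite -x0 -xm; apply: walk_cat (wseg _ _) (walk_cat (walk1 _ _) (wseg _ _) _) _;
  first [done | nlia | by rewrite e_sym].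
have c P : count P Q' + P w = count P Q + P y.
  rewrite wE /Q' !count_cat /= (@cQ _ i); last nlia.
  rewrite (@count_seg _ P Q i.+1 i.+1 m.-1) ?(@count_seg1 _ v P Q i.+1); nlia.
have hQ' : hpath e u v z Q'.
  by apply: (hpath_walk lQ (D := [:: y])) => // P; have := c P; rewrite /= addn0; nlia.
have sQ' : size Q' = m by have := c predT; rewrite !count_predT /=; nlia.
have lQ' : longest e u v z Q' by split=> // Q'' /(proj2 lQ); rewrite sQ'.
apply: (outside_adjacent G lQ'); rewrite !inE negb_or.
have wQ : w \in Q by apply: (succs_Q G lQ wS).
rewrite (contraNneq _ vQ) /=; last by move=> <-.
rewrite -has_pred1 has_count -leqNgt.
have := c (pred1 w); rewrite (count_uniq_mem w uniqQ) wQ /= eqxx.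
have -> : (y == w) = false by apply: contraNF yNQ => /eqP ->.
by nlia.
Qed.

Let r := #|outside v Q|.
Let sigma := #|S :&: R|.
Let eps := (u \in N) + (z \in N).

Let card_N : #|N| = k.-1.
Proof. by have := card_neighbours G lQ yR; rewrite (outside_adjacent G lQ yR); nlia. Qed.

(** The vertex [v] is adjacent to [S :&: R], to everything outside [Q], and to [u] and [z]; these
    sets are disjoint because [u] is no successor and [z] no predecessor. *)
Let sigma_le : sigma + r + 2 <= k.
Proof.
have sub : (S :&: R) :|: outside v Q :|: [set u; z] \subset nbhd e v.
  apply/subsetP => w; rewrite [w \in nbhd _ _]inE => /setUP[/setUP[/setIP[wS wR]|wR]|].
  - exact: exchange_adjacent.
  - exact: outside_adjacent G lQ wR.
  by rewrite !inE => /orP[] /eqP-> //; rewrite e_sym.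
have uQ : u \in Q by rewrite -x0 mem_nth.
have zQ : z \in Q by rewrite -xm mem_nth // prednK.
have := subset_leq_card sub; rewrite reg cardsU cardsU cards2 uz.
rewrite [X in _ - X + _](_ : _ = 0); last first.
  apply: eq_card0 => w; rewrite in_setI; apply/negP => /andP[/setIP[/(succs_Q G lQ) wQ _]].
  by rewrite !inE wQ orbT.
rewrite [X in _ + _ - X](_ : _ = 0) ?subn0 //.
apply: eq_card0 => w; rewrite in_setI; apply/negP => /andP[wS].
rewrite in_set2 => wuz; move: wS; case/orP: wuz => /eqP ->.
  by rewrite in_setU in_setI (negPf (succs_neq_u G lQ y)) !inE uQ orbT.
by rewrite in_setU in_setI (negPf (succs_neq_u Gr lQr y)) andbF !inE zQ orbT.
Qed.

Let cardS : #|S| + (z \in N) = k.-1.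
Proof. by rewrite -card_N; apply: (card_succs G lQ yR). Qed.
Let cardR : #|R| + (u \in N) = k.-1.
Proof. by rewrite -card_N -neighbours_on_rev; apply: (card_succs Gr lQr yRr). Qed.

(** As [v] is adjacent to [y], this is the whole neighbourhood of [y]. *)
Let X := v |: N.
Let Z := ~: X.
(* The vertices of [Z] other than [y] without a [Q]-neighbour in [N]. *)
Let B := Z :\: (S :|: R) :\ y.
Let P := S :\: R.
Let M := R :\: S.

Let card_T : #|T| = m.+1 + r.
Proof. by apply: card_outside; case: lQ => /andP[]. Qed.
Let vN : v \notin N. Proof. by rewrite inE negb_and vQ. Qed.
Let cardX : #|X| = k.
Proof. by rewrite cardsU1 vN card_N add1n prednK // (ltnW (setting_k2 G)). Qed.
Let cardZ : #|Z| + k = #|T|. Proof. by rewrite -cardX addnC cardsC. Qed.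
Let S_Z : S \subset Z.
Proof.
apply/subsetP => w wS; rewrite !in_setC in_setU1 negb_or.
have wQ := succs_Q G lQ wS.
apply/andP; split; first by apply: contraNneq vQ => <-.
by apply: contraTN wS => wN; apply: (contraTN (succs_nadj G lQ yR (p := w))); move: wN; rewrite inE => /andP[].
Qed.
Let R_Z : R \subset Z.
Proof.
apply/subsetP => w wS; rewrite !in_setC in_setU1 negb_or.
have wQ : w \in Q by rewrite -mem_rev; apply: (succs_Q Gr lQr wS).
apply/andP; split; first by apply: contraNneq vQ => <-.
by apply: contraTN wS => wN; apply: (contraTN (succs_nadj Gr lQr yRr (p := w))); move: wN; rewrite inE => /andP[].
Qed.
Let yZ : y \in Z. Proof. by rewrite !inE (negPf ynv) (negPf yNQ). Qed.

Let cardB : #|B| + 1 + #|S| + #|R| = #|Z| + sigma.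
Proof.
have yS : y \notin S :|: R.
  rewrite in_setU negb_or (contra (@succs_Q _ _ _ _ _ _ _ G lQ y y)) //=.
  by apply: (contra (@succs_Q _ _ _ _ _ _ _ Gr lQr y y)); rewrite mem_rev.
have /setIidPr SRZ : S :|: R \subset Z by rewrite subUset S_Z R_Z.
have := cardsID (S :|: R) Z; rewrite SRZ (cardsD1 y (Z :\: _)) in_setD yS yZ -/B /=.
by have := cardsUI S R; rewrite -/sigma; nlia.
Qed.

Let outside_sub_B : outside v Q :\ y \subset B.
Proof.
apply/subsetP => w; rewrite in_setD1 => /andP[wy wO]; rewrite in_setD1 wy in_setD in_setU negb_or.
have [wv wQ] : w != v /\ w \notin Q by apply/andP; move: wO; rewrite !inE negb_or.
rewrite (contra (@succs_Q _ _ _ _ _ _ _ G lQ y w)) //=.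
rewrite (contra (@succs_Q _ _ _ _ _ _ _ Gr lQr y w)) ?mem_rev //=.
by rewrite !inE (negPf wv) (negPf wQ).
Qed.


(** Inclusion-exclusion for [S] and [R] inside [Z] gives the last equation; with [sigma_le],
    [r <= #|B| + 1] and [eps <= 2] it leaves only [r = 1] and [#|B| <= 1]. *)
Lemma outside_single : [/\ r = 1, sigma + 3 <= k, #|B| <= 1 &
  #|T| + 1 + eps + sigma = 3 * k + #|B|].
Proof.
have hB : #|T| + 1 + eps + sigma = 3 * k + #|B|.
  by have := cardB; have := cardZ; have := cardS; have := cardR; rewrite /eps; nlia.
have yB : r <= #|B|.+1.
  rewrite /r (cardsD1 y) yR ltnS; exact: subset_leq_card outside_sub_B.
have r0 : 0 < r by apply/card_gt0P; exists y.
by split=> //; nlia.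
Qed.

Let B_props w : w \in B -> [/\ w \in Z, w \notin S, w \notin R & w != y].
Proof. by rewrite in_setD1 in_setD in_setU negb_or => /and3P[-> /andP[-> ->] ->]. Qed.

Let Z_cases w : w \in Z -> [\/ w = y, w \in S :&: R, w \in P :|: M | w \in B].
Proof.
move=> wZ; have [->|wy] := eqVneq w y; first by constructor 1.
have [wS|wS] := boolP (w \in S); have [wR|wR] := boolP (w \in R).
- by constructor 2; rewrite in_setI wS.
- by constructor 3; rewrite in_setU in_setD wS wR.
- by constructor 3; rewrite in_setU [w \in M]in_setD wS wR orbT.
- by constructor 4; rewrite in_setD1 wy in_setD wZ in_setU negb_or wS wR.
Qed.

Let y_nadj w : w \in Z -> ~~ e y w.
Proof.
move=> wZ; apply/negP => yw; have := wZ; rewrite in_setC in_setU1 negb_or => /andP[wv wN].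
have wO : w \in outside v Q.
  rewrite !inE negb_or wv; apply: contra wN => wQ; by rewrite inE wQ e_sym.
by have := outside_independent G lQ yR wO; rewrite yw.
Qed.

Let R_nadj2 p q : p \in R -> q \in R -> ~~ e p q.
Proof. exact: (succs_nadj2 Gr lQr yRr). Qed.

Let S_nadj2 p q : p \in S -> q \in S -> ~~ e p q.
Proof. exact: (succs_nadj2 G lQ yR). Qed.

(** Both [S] and [R] are independent, so an edge in their union has an end missing from [R] and an
    end missing from [S]. *)
Let PM_edge p q : p \in S :|: R -> q \in S :|: R -> e p q ->
  (p \in P) && (q \in M) || (p \in M) && (q \in P).
Proof.
rewrite !in_setU !in_setD => pSR qSR pq; apply: contraTT pq.
have [pS|pS] := boolP (p \in S); have [qS|qS] := boolP (q \in S).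
- by rewrite S_nadj2.
- move: qSR; rewrite (negPf qS) /= => qR; have [pR|pR] := boolP (p \in R); last by rewrite qR.
  by rewrite R_nadj2.
- move: pSR; rewrite (negPf pS) /= => pR; have [qR|qR] := boolP (q \in R); last by rewrite pR.
  by rewrite R_nadj2.
by move: pSR qSR; rewrite (negPf pS) (negPf qS) /= => pR qR; rewrite R_nadj2.
Qed.

Let PM_bound w : w \in P :|: M -> w \in S :|: R.
Proof. by rewrite !in_setU !in_setD => /orP[] /andP[_ ->]; rewrite ?orbT. Qed.

Let B1 p q : p \in B -> q \in B -> p = q.
Proof. by case: outside_single => _ _ /card_le1_eqP h _ pB qB; exact: (h q p qB pB). Qed.

Let both_PM w : w \in S :&: R -> (w \in P) = false /\ (w \in M) = false.
Proof. by rewrite in_setI [w \in P]in_setD [w \in M]in_setD => /andP[-> ->]. Qed.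

(** Inside [Z], [y] is isolated and [B] has at most one vertex, so the remaining edges join two
    different sets among [P], [M], [B]. *)
Let nbhd_sub w : (forall s b, s \in S :&: R -> b \in B -> ~~ e s b) -> w \in Z ->
  nbhd e w :&: Z \subset (if w \in P then M :|: B else set0) :|:
    (if w \in M then P :|: B else set0) :|: (if w \in B then P :|: M else set0).
Proof.
move=> SB wZ.
apply/subsetP => q /setIP[]; rewrite inE => wq qZ.
have wy : w != y by apply: contraTneq wq => ->; apply: y_nadj.
have qy : q != y by apply: contraTneq wq => ->; rewrite e_sym; apply: y_nadj.
have [wE|wS|wS|wB] := Z_cases wZ; first by rewrite wE eqxx in wy.
- have [qE|qS|qS|qB] := Z_cases qZ; first by rewrite qE eqxx in qy.
  + by move: wS qS wq; rewrite !in_setI => /andP[wS _] /andP[qS _]; rewrite (negPf (S_nadj2 wS qS)).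
  + have wSR : w \in S :|: R by move: wS; rewrite in_setI in_setU => /andP[->].
    by have := PM_edge wSR (PM_bound qS) wq; have [-> ->] := both_PM wS.
  by have := SB w q wS qB; rewrite wq.
- have [qE|qS|qS|qB] := Z_cases qZ; first by rewrite qE eqxx in qy.
  + have qSR : q \in S :|: R by move: qS; rewrite in_setI in_setU => /andP[->].
    by have := PM_edge (PM_bound wS) qSR wq; have [-> ->] := both_PM qS; rewrite !andbF.
  + have /orP[/andP[wP qM]|/andP[wM qP]] := PM_edge (PM_bound wS) (PM_bound qS) wq.
      by rewrite !in_setU wP /= in_setU qM.
    by rewrite !in_setU wM /= in_setU qP /= orbT.
  by move: wS; rewrite in_setU => /orP[] wS; rewrite !in_setU wS /= in_setU qB ?orbT /= ?orbT.
have [qE|qS|qS|qB] := Z_cases qZ; first by rewrite qE eqxx in qy.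
- by have := SB q w qS wB; rewrite e_sym wq.
- by rewrite !in_setU wB /= qS orbT.
by move: wq; rewrite (B1 wB qB) e_irr.
Qed.

Let deg_bound w : (forall s b, s \in S :&: R -> b \in B -> ~~ e s b) -> w \in Z ->
  deg_in e Z w <= (w \in P) * (#|M| + #|B|) + (w \in M) * (#|P| + #|B|)
                  + (w \in B) * (#|P| + #|M|).
Proof.
move=> SB wZ; apply: leq_trans (subset_leq_card (nbhd_sub SB wZ)) _.
apply: leq_trans (leq_card_setU _ _) (leq_add (leq_trans (leq_card_setU _ _) (leq_add _ _)) _);
  case: ifP => _; rewrite ?cards0 ?mul1n //; exact: leq_card_setU.
Qed.

Let sum_mem (A : {set T}) c : A \subset Z -> \sum_(w in Z) (w \in A) * c = #|A| * c.
Proof.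
move=> AZ; rewrite -big_distrl /=; congr (_ * _).
rewrite -sum1_card [RHS]big_mkcond [LHS]big_mkcond; apply: eq_bigr => w _.
by have [/(subsetP AZ) ->|] := boolP (w \in A); rewrite //= if_same.
Qed.

Let P_Z : P \subset Z. Proof. exact: subset_trans (subsetDl _ _) S_Z. Qed.
Let M_Z : M \subset Z. Proof. exact: subset_trans (subsetDl _ _) R_Z. Qed.
Let B_Z : B \subset Z. Proof. by apply/subsetP => w /B_props[]. Qed.

Let sum_bound : (forall s b, s \in S :&: R -> b \in B -> ~~ e s b) ->
  \sum_(w in Z) deg_in e Z w <= 2 * (#|P| * #|M| + #|B| * (#|P| + #|M|)).
Proof.
move=> SB; apply: (@leq_trans (\sum_(w in Z) ((w \in P) * (#|M| + #|B|) +
    (w \in M) * (#|P| + #|B|) + (w \in B) * (#|P| + #|M|)))).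
  by apply: leq_sum => w; apply: deg_bound SB.
rewrite !big_split /= !sum_mem ?P_Z ?M_Z ?B_Z //; nlia.
Qed.

(** [deg_in_compl] for [X], where the edges from [v] to those of [u], [z] in [N] contribute
    [2 * eps] to the inner degree sum. *)
Let sum_X : k * #|Z| + 2 * eps <= \sum_(w in Z) deg_in e Z w + k * k.
Proof.
have := deg_in_compl e_sym reg X; rewrite -/Z cardX => ->; rewrite leq_add2l.
have epsE : eps = #|[set w in [:: u; z] | w \in N]| by rewrite card_pair_filter.
rewrite big_setU1 //= mul2n -addnn; apply: leq_add.
  rewrite epsE; apply/subset_leq_card/subsetP => w; rewrite inE => /andP[wuz wN].
  rewrite in_setI in_setU1 wN orbT andbT inE.
  by move: wuz; rewrite !inE => /orP[] /eqP->; rewrite // e_sym.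
have sub : [set w in [:: u; z] | w \in N] \subset N.
  by apply/subsetP => w; rewrite inE => /andP[].
rewrite epsE -sum1_card [leqRHS](big_setID [set w in [:: u; z] | w \in N]) /= [N :&: _](setIidPr sub).
apply: leq_trans (leq_addr _ _); apply: leq_sum => w; rewrite inE => /andP[wuz _].
apply/card_gt0P; exists v; rewrite in_setI setU11 andbT inE.
by move: wuz; rewrite !inE => /orP[] /eqP->; rewrite // e_sym.
Qed.

Let card_P : #|P| + sigma = #|S|.
Proof. by rewrite addnC /sigma; apply: cardsID. Qed.
Let card_M : #|M| + sigma = #|R|.
Proof. by rewrite addnC /sigma setIC; apply: cardsID. Qed.

(** The sizes of [P] and [M] follow from [outside_single], and [sum_X] is played against
    [sum_bound]. For [#|B| = 1] the two bounds conflict unless [B] has an edge to [S :&: R]. *)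
Let few_cases : [/\ u \in N, z \in N, #|T| = k.*2.+1 &
  (#|B| = 0 /\ k = 4) \/
  [/\ #|B| = 1, #|P| = 1, #|M| = 1 & exists s b, [/\ s \in S :&: R, b \in B & e s b]]].
Proof.
have [r1 sk b1 hB] := outside_single.
have hX := sum_X; have cS := cardS; have cR := cardR; have cP := card_P; have cM := card_M.
have cZ := cardZ.
have [B0|B1'] : #|B| = 0 \/ #|B| = 1 by nlia.
  have SB s b : s \in S :&: R -> b \in B -> ~~ e s b by move=> _; rewrite (cards0_eq B0) in_set0.
  have := leq_trans hX (leq_add (sum_bound SB) (leqnn _)); rewrite B0 mul0n addn0 => h.
  have [n2|n2] : #|T| = k.*2 \/ #|T| = k.*2.+1 by nlia.
    have [P1 M1] : #|P| = 1 /\ #|M| = 1 by rewrite /eps in hB; nlia.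
    have E : #|Z| = k by nlia.
    by rewrite P1 M1 E in h; rewrite /eps in hB h; nlia.
  have Zk : #|Z| = k.+1 by nlia.
  rewrite Zk mulnS in h; rewrite /eps in hB h.
  (* If both ends are in [N], the bounds give [k <= 4] and [sigma >= 0] gives [k >= 4]; with one end
     in [N], [sum_X] fails. *)
  have [uN|uN] := boolP (u \in N); have [zN|zN] := boolP (z \in N);
    rewrite ?uN ?zN ?(negPf uN) ?(negPf zN) in hB h cS cR; last by nlia.
  - have [P2 M2] : #|P| = 2 /\ #|M| = 2 by nlia.
    by rewrite P2 M2 in h; split=> //; left; split=> //; nlia.
  - have [P2 M2] : #|P| = 2 /\ #|M| = 1 by nlia.
    by rewrite P2 M2 in h; nlia.
  have [P2 M2] : #|P| = 1 /\ #|M| = 2 by nlia.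
  by rewrite P2 M2 in h; nlia.
have [n2 e2] : #|T| = k.*2.+1 /\ eps = 2 by nlia.
have [uN zN] : u \in N /\ z \in N.
  by move: e2; rewrite /eps; case: (u \in N); case: (z \in N).
rewrite uN in cR; rewrite zN in cS.
have [P1 M1] : #|P| = 1 /\ #|M| = 1 by nlia.
split=> //; right; split=> //.
suff /existsP[s /existsP[b /and3P[*]]] :
  [exists s, exists b, [&& s \in S :&: R, b \in B & e s b]] by exists s, b.
apply: contraT => /existsPn nE.
have SB s b : s \in S :&: R -> b \in B -> ~~ e s b.
  by move=> sSR bB; have /existsPn/(_ b) := nE s; rewrite sSR bB.
have := leq_trans hX (leq_add (sum_bound SB) (leqnn _)); rewrite P1 M1 B1' e2.
have Zk : #|Z| = k.+1 by nlia.
by rewrite Zk mulnS; nlia.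
Qed.

(** The degree sum inside [Z] must be at least 8, which the four possible edges between [P] and [M]
    reach only if all are present. *)
Let complete_PM p q : #|B| = 0 -> k = 4 -> p \in P -> q \in M -> e p q.
Proof.
move=> B0 k4 pP qM; apply: contraT => npq.
have [r1 sk b1 hB] := outside_single; have [uN zN n2 _] := few_cases.
have hX := sum_X; have cS := cardS; have cR := cardR; have cP := card_P; have cM := card_M.
have cZ := cardZ; rewrite uN in cR; rewrite zN in cS; rewrite /eps uN zN in hB hX.
have SB s b : s \in S :&: R -> b \in B -> ~~ e s b by move=> _; rewrite (cards0_eq B0) in_set0.
have [P2 M2] : #|P| = 2 /\ #|M| = 2 by nlia.
have pZ := subsetP P_Z _ pP.
have pM : (p \in M) = false by move: pP; rewrite !in_setD => /andP[/negPf-> ->].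
have pB : (p \in B) = false by rewrite (cards0_eq B0) inE.
have dp : deg_in e Z p <= 1.
  have : nbhd e p :&: Z \subset M :\ q.
    apply/subsetP => t tp; have := subsetP (nbhd_sub SB pZ) t tp.
    rewrite pP pM pB !setU0 (cards0_eq B0) setU0 in_setD1 => ->; rewrite andbT.
    by apply: contraNneq npq => <-; move: tp; rewrite in_setI inE => /andP[].
  move/subset_leq_card/leq_trans; apply.
  by have := cardsD1 q M; rewrite qM M2; nlia.
have : \sum_(w in Z) deg_in e Z w < 8.
  have sb : \sum_(w in Z) ((w \in P) * (#|M| + #|B|) +
      (w \in M) * (#|P| + #|B|) + (w \in B) * (#|P| + #|M|)) = 8.
    by rewrite !big_split /= !sum_mem ?P_Z ?M_Z ?B_Z // P2 M2 B0.
  have le : \sum_(w in Z | w != p) deg_in e Z w <= \sum_(w in Z | w != p)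
      ((w \in P) * (#|M| + #|B|) + (w \in M) * (#|P| + #|B|) + (w \in B) * (#|P| + #|M|)).
    by apply: leq_sum => w /andP[wZ _]; apply: deg_bound SB wZ.
  rewrite [ltnLHS](bigD1 p) //=; move: sb; rewrite (bigD1 p) //=; move: le; rewrite pP pM pB M2 B0.
  rewrite !mul0n !addn0; move: (\sum_(_ in _ | _) _) => s1.
  by move: (\sum_(_ in _ | _) _) => s2; move: dp; nlia.
have Z5 : #|Z| = 5 by nlia.
by move: hX; rewrite Z5 k4; nlia.
Qed.

Lemma spanning_absurd : False.
Proof.
have [uN zN n2 cases] := few_cases; have [r1 sk b1 hB] := outside_single.
have yx0 : e (x 0) y by rewrite -xN // x0.
have yxm : e (x m.-1) y by rewrite -xN ?prednK // xm.
have mk : m = k.*2.-1 by have := card_T; nlia.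
case: cases => [[B0 k4]|[B1' P1 M1 [s [b [sSR bB sb]]]]].
  (* First configuration: [y] has exactly the neighbours [x 0], [x 3], [x 6] on a path of 7
     vertices. *)
  have m7 : m = 7 by nlia.
  have sg0 : sigma = 0 by rewrite /eps uN zN in hB; nlia.
  have noSR i : i.+2 < m -> e (x i) y -> e (x i.+2) y -> False.
    move=> im xi xi2; have : x i.+1 \in S :&: R.
      rewrite in_setI; apply/andP; split; first by apply/(succsP G lQ); exists i; split=> //; nlia.
      by apply/predsP; exists i.+1.
    by rewrite (cards0_eq sg0) inE.
  have [i [im i0 i6 xi]] : exists i, [/\ i < m, i != 0, i != 6 & e (x i) y].
    have : 0 < #|N :\ u :\ z|.
      have := cardsD1 u N; have := cardsD1 z (N :\ u).
      by rewrite uN in_setD1 eq_sym uz zN card_N k4; nlia.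
    case/card_gt0P => w; rewrite !in_setD1 => /and3P[wz wu /(neighbours_onP v)[i im [wE xi]]].
    exists i; split=> //; first by apply: contraNneq wu => i0; rewrite wE i0 x0.
    by apply: contraNneq wz => i6; rewrite wE -xm m7 i6.
  have yx6 : e (x 6) y by have := yxm; rewrite m7.
  have i3 : i = 3.
    have i1 : i != 1 by apply: contraTneq xi => ->; apply/negP => h; have := gap (ltnSn 0) _ yx0 h; rewrite m7 => /(_ isT).
    have i5 : i != 5 by apply: contraTneq xi => ->; apply/negP => h; have := gap (ltnSn 5) _ h yx6; rewrite m7 => /(_ isT).
    have i2 : i != 2 by apply: contraTneq xi => ->; apply/negP => h; apply: (noSR 0) => //; rewrite m7.
    have i4 : i != 4 by apply: contraTneq xi => ->; apply/negP => h; apply: (noSR 4) => //; rewrite m7.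
    by nlia.
  rewrite {i}i3 in xi im i0 i6.
  have notboth w : w \in S -> w \notin R.
    by move=> wS; have := in_set0 w; rewrite -(cards0_eq sg0) in_setI wS /= => ->.
  have inP i : i.+1 < m -> e (x i) y -> x i.+1 \in P.
    move=> im' xi'; have wS : x i.+1 \in S by apply/(succsP G lQ); exists i.
    by rewrite in_setD wS notboth.
  have inM i : i.+1 < m -> e (x i.+1) y -> x i \in M.
    move=> im' xi'; have wR : x i \in R by apply/predsP; exists i.
    by rewrite in_setD wR andbT; apply: contraL wR => /notboth.
  have e15 : e (x 1) (x 5) by apply: complete_PM => //; [apply: inP | apply: inM]; rewrite ?m7.
  have e42 : e (x 4) (x 2) by apply: complete_PM => //; [apply: inP | apply: inM]; rewrite ?m7.
  (* The longer path is [x 0, x 1, x 5, x 4, x 2, x 3, y, x 6]. *)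
  apply: (no_longer (Q' := seg Q 0 1 ++ rev (seg Q 4 5) ++ seg Q 2 3 ++ [:: y] ++ seg Q 6 6)).
    rewrite -x0 -xm m7 /=.
    apply: walk_cat (wseg _ _) (walk_cat (walk_rev e_sym (wseg _ _)) (walk_cat (wseg _ _)
      (walk_cat (walk1 _ _) (wseg _ _) _) _) _) _; rewrite ?m7 //; by rewrite e_sym.
  move=> A; rewrite !count_cat count_rev /= (@cQ A 1) ?m7 //.
  by rewrite (@count_seg _ A Q 2 3 6) // (@count_seg _ A Q 4 5 6) //; nlia.
have [bZ bS bR bNy] := B_props bB.
have [bv bN] : b != v /\ b \notin N.
  by apply/andP; move: bZ; rewrite in_setC in_setU1 negb_or.
(* Second configuration: [b] lies on [Q], since [y] is the only vertex outside. *)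
have /xQ[j jm bE] : b \in Q.
  apply: contraT => bQ; have bO : b \in outside v Q by rewrite !inE negb_or bv.
  have yO : y \in outside v Q := yR.
  have /card_le1_eqP h : #|outside v Q| <= 1 by rewrite -/r r1.
  by move: bNy; rewrite (h b y bO yO) eqxx.
have j0 : j != 0 by apply: contraNneq bN => j0; rewrite bE j0 x0.
have jl : j != m.-1 by apply: contraNneq bN => jl; rewrite bE jl xm.
have jm1 : j.+1 < m by nlia.
have inZ i : i < m -> ~~ e (x i) y -> x i \in Z.
  move=> im xi; rewrite in_setC in_setU1 negb_or xN // xi andbT.
  by apply: contraNneq vQ => <-; apply: mem_nth.
have noty i : i < m -> x i = y -> False.
  by move=> im xi; move: yNQ; rewrite -xi mem_nth.
have notB i : i < m -> i != j -> x i \notin B.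
  move=> im ij; apply/negP => iB; have := B1 iB bB; rewrite bE => /x_inj h.
  by rewrite h ?eqxx in ij.
(* As [b] is in none of [N], [S], [R], its neighbours on [Q] lie in [Z], the left one outside [R]
   and the right one outside [S]; so they are the single vertices of [P] and [M]. *)
have lP : x j.-1 \in P.
  have jl1 : j.-1 < m by nlia.
  have jj : j.-1 != j by nlia.
  have nl : ~~ e (x j.-1) y.
    by apply: contra bS => h; rewrite bE; apply/(succsP G lQ); exists j.-1; rewrite prednK //; nlia.
  have nR : x j.-1 \notin R.
    apply/negP => /predsP[i [im xi]] /x_inj h; have ij : j.-1 = i by apply: h; nlia.
    move: xi; rewrite -ij prednK; last by nlia.
    by move=> h'; move: bN; rewrite bE xN ?h'.
  have [E|SR|PM|iB] := Z_cases (inZ _ jl1 nl).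
  - by case: (noty _ jl1 E).
  - by move: SR; rewrite in_setI (negPf nR) andbF.
  - by move: PM; rewrite in_setU [_ \in M]in_setD (negPf nR) andbF orbF.
  - by move: (notB _ jl1 jj); rewrite iB.
have rM : x j.+1 \in M.
  have jj : j.+1 != j by nlia.
  have nl : ~~ e (x j.+1) y.
    by apply: contra bR => h; rewrite bE; apply/predsP; exists j.
  have nS : x j.+1 \notin S.
    apply/negP => /(succsP G lQ)[i [im xi]] /x_inj h; have ij : j.+1 = i.+1 by apply: h.
    by case: ij => ij; move: bN; rewrite bE xN // ij xi.
  have [E|SR|PM|iB] := Z_cases (inZ _ jm1 nl).
  - by case: (noty _ jm1 E).
  - by move: SR; rewrite in_setI (negPf nS).
  - by move: PM; rewrite in_setU [_ \in P]in_setD (negPf nS) andbF.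
  - by move: (notB _ jm1 jj); rewrite iB.
(* Otherwise [Z :\ b] is an independent set of [k] vertices avoiding [u], [v] and [z]. *)
have elr : e (x j.-1) (x j.+1).
  apply: contraT => nlr.
  have PE p : p \in P -> p = x j.-1.
    by move=> pP; have /card_le1_eqP h : #|P| <= 1; [rewrite P1 | apply: (h (x j.-1) p)].
  have ME p : p \in M -> p = x j.+1.
    by move=> pM; have /card_le1_eqP h : #|M| <= 1; [rewrite M1 | apply: (h (x j.+1) p)].
  have iZ : independent e (Z :\ b).
    move=> p q; rewrite !in_setD1 => /andP[pb pZ] /andP[qb qZ]; apply/negP => pq.
    have SRI w : w \in S :&: R -> w \in S :|: R by rewrite in_setI in_setU => /andP[->].
    have pS : p \in S :|: R.
      have [E|/SRI//|/PM_bound//|pB] := Z_cases pZ; last by rewrite (B1 pB bB) eqxx in pb.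
      by move: pq; rewrite E (negPf (y_nadj qZ)).
    have qS : q \in S :|: R.
      have [E|/SRI//|/PM_bound//|qB] := Z_cases qZ; last by rewrite (B1 qB bB) eqxx in qb.
      by move: pq; rewrite E e_sym (negPf (y_nadj pZ)).
    case/orP: (PM_edge pS qS pq) => /andP[/[dup] h1 + /[dup] h2].
      by move=> /PE E1 /ME E2; move: nlr; rewrite -E1 -E2 pq.
    by move=> /ME E1 /PE E2; move: nlr; rewrite -E1 -E2 e_sym pq.
  have := independent_avoiding_card G iZ.
  have notin w : w \in X -> w \notin Z :\ b by rewrite in_setD1 in_setC => ->; rewrite andbF.
  move/(_ (notin u _) (notin v _) (notin z _)); rewrite !in_setU1 uN zN eqxx !orbT => /(_ isT isT isT).
  by have := cardsD1 b Z; rewrite bZ; have := cardZ; nlia.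
have [i0 [i0m xi0 jE]] : exists i, [/\ i.+1 < m, e (x i) y & x j.-1 = x i.+1].
  by move: lP; rewrite in_setD => /andP[_ /(succsP G lQ)].
have {jE} jE : j.-1 = i0.+1 by apply: x_inj jE => //; nlia.
have [i2 [i2m xi2 jE2]] : exists i, [/\ i.+1 < m, e (x i.+1) y & x j.+1 = x i].
  by move: rM; rewrite in_setD => /andP[_ /predsP].
have {jE2} jE2 : j.+1 = i2 by apply: x_inj jE2 => //; nlia.
have [h [hm xh xh2 sE]] : exists i, [/\ i.+2 < m, e (x i) y, e (x i.+2) y & s = x i.+1].
  by move: sSR; rewrite in_setI => /andP[sS sR]; apply: succs_predsP.
have hj1 : h.+1 != j.+1.
  apply/negP => /eqP hj; have := sSR; rewrite sE hj in_setI.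
  by move: rM; rewrite in_setD => /andP[/negPf->].
have hj2 : h.+1 != j.-1.
  apply/negP => /eqP hj; have := sSR; rewrite sE hj in_setI.
  by move: lP; rewrite in_setD => /andP[/negPf->]; rewrite andbF.
have hj3 : h.+1 != j.
  by apply: contraTneq sb => hj; rewrite sE bE hj e_irr.
rewrite sE bE in sb; subst i2.
have jl1 : e (x j.-1) (x j.+1) := elr.
have [jlt|jgt] : j.+1 < h.+1 \/ h.+1 < j.-1 by nlia.
  (* With [s = x h.+1] on the right: [x 0 .. x j.-2], [y], [x h] back to [x j.+1], [x j.-1], [b],
     then [s .. z]. *)
  apply: (no_longer (Q' := seg Q 0 i0 ++ [:: y] ++ rev (seg Q j.+1 h) ++ seg Q j.-1 j ++ seg Q h.+1 m.-1)).
    rewrite -x0 -xm; apply: walk_cat (wseg _ _) (walk_cat (walk1 _ _) (walk_cat (walk_rev e_sym (wseg _ _))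
      (walk_cat (wseg _ _) (wseg _ _) _) _) _) _; first [done | nlia | by rewrite e_sym].
  move=> A; rewrite !count_cat count_rev /= (@cQ A i0); last by nlia.
  by rewrite -jE (@count_seg _ A Q j.-1 j m.-1) ?(@count_seg _ A Q j.+1 h m.-1); nlia.
(* With [s] on the left: [x 0 .. s], [b], [x j.+1], [x j.-1] back to [x h.+2], [y], then
   [x j.+2 .. z]. *)
apply: (no_longer (Q' := seg Q 0 h.+1 ++ seg Q j j.+1 ++ rev (seg Q h.+2 j.-1) ++ [:: y] ++ seg Q j.+2 m.-1)).
  rewrite -x0 -xm; apply: walk_cat (wseg _ _) (walk_cat (wseg _ _) (walk_cat (walk_rev e_sym (wseg _ _))
    (walk_cat (walk1 _ _) (wseg _ _) _) _) _) _; first [done | nlia | by rewrite e_sym].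
move=> A; rewrite !count_cat count_rev /= (@cQ A h.+1); last by nlia.
rewrite (@count_seg _ A Q h.+2 j.-1 m.-1) ?prednK ?(@count_seg _ A Q j j.+1 m.-1); nlia.
Qed.

End Spanning.

(** * Existence of a longest path, and the Hamiltonian cycle *)

Lemma longest_exists (T : finType) (e : rel T) (u v z : T) (Q : seq T) :
  hpath e u v z Q -> exists Q', longest e u v z Q'.
Proof.
move=> hQ; pose p n := [exists t : n.-tuple T, hpath e u v z t].
have ex : exists n, p n by exists (size Q); apply/existsP; exists (in_tuple Q).
have bd n : p n -> n <= #|T|.
  case/existsP => t /andP[/= /andP[_ ut] _].
  by rewrite -(size_tuple t) -(card_uniqP ut) max_card.
case: (ex_maxnP ex bd) => n /existsP[t ht] mx; exists t; split=> // Q' hQ'.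
by rewrite size_tuple; apply: mx; apply/existsP; exists (in_tuple Q').
Qed.

Lemma connected_hpath (T : finType) (e : rel T) (u v z : T) :
  connected_on e [set~ v] -> u != v -> z != v -> exists Q, hpath e u v z Q.
Proof.
move=> c uv zv; have /connectP[q0 pq0 zE] : connect (induced_rel e [set~ v]) u z.
  by apply: c; rewrite !inE.
rewrite zE; case/shortenP: pq0 => q pq uq _; exists (u :: q).
rewrite /hpath /= in uq *; rewrite uq andbT; apply/andP; split; last first.
  by apply: walk_path; apply: sub_path pq => c' d /and3P[].
rewrite inE negb_or eq_sym uv /=.
elim: q u pq {uq zE uv} => //= w q IH u /andP[/and3P[_ _ wv] /IH].
by rewrite inE negb_or => ->; move: wv; rewrite !inE eq_sym => ->.
Qed.

Theorem theorem3 (T : finType) (e : rel T) (k : nat) (u v z : T) :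
  0 < k ->
  simple_graph e ->
  two_connected e ->
  k_regular e k ->
  [/\ u != v, v != z & u != z] -> e u v -> e v z ->
  connected_on e (~: [set u; v; z]) ->
  ~ in_classH e k u v z ->
  #|T| <= k.*2.+1 ->
  exists c : seq T, [/\ ham_cycle e c, cycle_has_edge c u v & cycle_has_edge c v z].
Proof.
move=> _ sg tc reg dist euv evz c3 nH nk.
have G : setting e k u v z by split; split.
have [e_sym _] := sg; have [uv vz uz] := dist; have [T3 [_ conn]] := tc.
have zv : z != v by rewrite eq_sym.
have [Q0 hQ0] := connected_hpath (conn v) uv zv.
have [Q lQ] := longest_exists hQ0.
have out0 : #|outside v Q| = 0.
  by apply: eq_card0 => y; apply/negP => /(spanning_absurd G lQ).
have uniqvQ : uniq (v :: Q) by case: lQ => /andP[].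
have cT := card_outside uniqvQ; rewrite out0 addn0 in cT.
have [m0 x0 xm uQ vQ] := longest_ends lQ.
have /and4P[_ sQ /eqP hQ /eqP lastQ] : walk e u z Q by case: lQ => /andP[].
have zQ : z \in Q by rewrite -xm mem_nth // prednK.
exists (v :: Q); split.
- split; rewrite ?cT //; first by rewrite /= -cT.
  case: Q {lQ out0 uniqvQ cT x0 xm uQ vQ zQ} m0 sQ hQ lastQ => //= w s _ ps wu lz.
  by rewrite rcons_path ps lz wu /= (e_sym v) (e_sym z) euv evz.
- have uQ' : u \in Q by rewrite -x0 mem_nth.
  rewrite /cycle_has_edge in_cons uQ' orbT mem_head /=; apply/orP; right.
  by case: Q {lQ out0 uniqvQ cT x0 xm uQ vQ zQ uQ' lastQ sQ} m0 hQ => //= w s _ ->; rewrite !eqxx.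
(* Since [z] is last, [next] reads past the end of [Q] and returns its default, the head [v]. *)
have nz : next (v :: Q) z = v.
  rewrite next_nth in_cons zQ orbT /= (negPf vz) -[in index _ _]xm index_uniq // ?prednK //.
  by rewrite nth_default.
by rewrite /cycle_has_edge mem_head in_cons zQ nz eqxx !orbT.
Qed.
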